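(* Suppose the half spaces $H_1^+,\dots,H_m^+\subset\mathbb{R}^n$ satisfy the good clipping conditions: (A) for every $I\subset[m-1]$, $F^{|I|-1}\cap H_I=\varnothing$; (B) for every $I\subset[m-1]$ and every $\mathbf{v}\in F^{|I|}\cap H_I$, $\ \prod_{t\in I}A_{*_{\mathbf{v}}}^{(I\setminus t)\cup m}\ \prod_{t\in\bullet_{\mathbf{v}}}A_{*_{\mathbf{v}}\cup t}^{I\cup m}\ne 0$. Then $$\operatorname{vol}([0,1]^n\cap H^+)=\sum_{I\subset[m-1]}\;\sum_{\mathbf{v}\in F^{|I|}\cap H_I}\frac{(-1)^{|0_{\mathbf{v}}|+\|*_{\mathbf{v}}\|}\,\bigl(g_m(\mathbf{v})\,A_{*_{\mathbf{v}}}^{I}\bigr)^n}{n!\,\bigl|A_{*_{\mathbf{v}}}^{I}\bigr|\,\prod_{t\in I}A_{*_{\mathbf{v}}}^{(I\setminus t)\cup m}\,\prod_{t\in\bullet_{\mathbf{v}}}A_{*_{\mathbf{v}}\cup t}^{I\cup m}} .$$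
   Context: $n,m\ge 1$, $[k]=\{1,\dots,k\}$ (with $[0]=\varnothing$). For $i\in[m]$, $g_i(\mathbf{x})=a_{1,i}x_1+\cdots+a_{n,i}x_n+r_i$ is a non-constant real affine function on $\mathbb{R}^n$, $H_i=\{g_i=0\}$, $H_i^+=\{g_i\ge 0\}$, $H^+=\bigcap_{i\in[m]}H_i^+$, and $A=(a_{j,i})$ is the $n\times m$ coefficient matrix (the $i$-th column is the coefficient vector of $g_i$). For $I\subset[m-1]$, $H_I=\bigl(\bigcap_{i\in I}H_i\bigr)\cap H^+\setminus H_m$. $F^d$ is the set of points of $[0,1]^n$ having exactly $d$ coordinates different from $0$ and $1$ (and $F^{-1}=\varnothing$). For $\mathbf{v}\in\mathbb{R}^n$: $0_{\mathbf{v}}=\{i: v_i=0\}$, $1_{\mathbf{v}}=\{i: v_i=1\}$, $*_{\mathbf{v}}=\{i: v_i\ne 0,1\}$, $\bullet_{\mathbf{v}}=0_{\mathbf{v}}\cup 1_{\mathbf{v}}$. For index sets $J\subset[n]$ and $K\subset[m]$ with $|J|=|K|$, $A_J^K$ is the determinant of the submatrix of $A$ with rows $J$ and columns $K$, both in increasing order; $A_\varnothing^\varnothing=1$. $\cup$ is ordinary union (result listed in increasing order), and a single index $t$ or $m$ stands for the one-element set. $|S|$ is cardinality and $\|S\|$ is the sum of the elements of $S$. $\operatorname{vol}$ is Lebesgue measure. *)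

(* Defs.v *)
From HB Require Import structures.
From mathcomp Require Import all_boot all_order all_algebra.
From mathcomp Require Import all_classical all_reals all_analysis.

Set Implicit Arguments.
Unset Strict Implicit.
Unset Printing Implicit Defensive.

Import Order.TTheory GRing.Theory Num.Theory.

Local Open Scope classical_set_scope.
Local Open Scope ring_scope.

(* Points of R^n are tuples, the type on which the library puts the product
   sigma-algebra.  The m >= 1 half-spaces are indexed by 'I_m.+1, the
   distinguished last index being ord_max; "I contained in [m-1]" is then
   ord_max \notin I.  Ordinals count from 0. *)

Section LebesgueMeasureTuple.
Context {R : realType}.

Definition tcons n (p : R * n.-tuple R) : n.+1.-tuple R := [tuple of p.1 :: p.2].

Lemma measurable_tcons n : measurable_fun [set: R * n.-tuple R] (@tcons n).
Proof. by apply: measurable_cons. Qed.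

Section Step.
Variables (n : nat) (mu : {sigma_finite_measure set (n.-tuple R) -> \bar R}).

Definition lebesgue_step : set (n.+1.-tuple R) -> \bar R :=
  pushforward (lebesgue_measure \x mu)%E (@tcons n).

Let lebesgue_step0 : lebesgue_step set0 = 0%E.
Proof. by rewrite /lebesgue_step /pushforward preimage_set0 measure0. Qed.

Let lebesgue_step_ge0 A : (0 <= lebesgue_step A)%E.
Proof. by rewrite /lebesgue_step /pushforward measure_ge0. Qed.

Let lebesgue_step_sigma_additive : semi_sigma_additive lebesgue_step.
Proof.
move=> F mF tF mUF; rewrite /lebesgue_step /pushforward preimage_bigcup.
apply: measure_semi_sigma_additive.
- by move=> k; rewrite -[X in measurable X]setTI; exact: measurable_tcons.
- by apply/trivIsetP => /= i j _ _ ij; rewrite -preimage_setI;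
    move/trivIsetP : tF => /(_ _ _ _ _ ij) ->//; rewrite preimage_set0.
- rewrite -preimage_bigcup -[X in measurable X]setTI.
  exact: measurable_tcons.
Qed.

HB.instance Definition _ := isMeasure.Build _ _ _ lebesgue_step
  lebesgue_step0 lebesgue_step_ge0 lebesgue_step_sigma_additive.

Let lebesgue_step_sigma_finite : sigma_finite setT lebesgue_step.
Proof.
have /sigma_finiteP[F [TF ndF Foo]] :=
  sigma_finiteT (@lebesgue_measure R : {sigma_finite_measure set _ -> \bar R}).
have /sigma_finiteP[G [TG ndG Goo]] := sigma_finiteT mu.
exists (fun k => [set t | F k (thead t) /\ G k [tuple of behead t]]).
  rewrite predeqE => t; split=> // _.
  have [k _ Fk] : (\bigcup_k F k) (thead t) by rewrite -TF.
  have [l _ Gl] : (\bigcup_k G k) [tuple of behead t] by rewrite -TG.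
  exists (maxn k l) => //; split.
    by move: Fk; exact/subsetPset/ndF/leq_maxl.
  by move: Gl; exact/subsetPset/ndG/leq_maxr.
move=> k; have [mFk Fk] := Foo k; have [mGk Gk] := Goo k; split.
  apply: measurableI.
    by rewrite -[X in measurable X]setTI; exact: measurable_tnth.
  by rewrite -[X in measurable X]setTI; exact: measurable_behead.
rewrite /lebesgue_step /pushforward (_ : _ @^-1` _ = F k `*` G k).
  by rewrite product_measure1E// lte_mul_pinfty// ge0_fin_numE.
apply/seteqP; split=> -[x t] /=; rewrite /thead (tnth_nth 0)/=.
  by rewrite (_ : [tuple of _] = t)//; exact: val_inj.
by rewrite (_ : [tuple of _] = t)//; exact: val_inj.
Qed.

HB.instance Definition _ := Measure_isSigmaFinite.Build _ _ _ lebesgue_step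
  lebesgue_step_sigma_finite.

End Step.

(* n-fold product of the one-dimensional Lebesgue measure. *)
Fixpoint vol n : {sigma_finite_measure set (n.-tuple R) -> \bar R} :=
  match n with
  | 0 => \d_([tuple] : 0.-tuple R)
  | n'.+1 => lebesgue_step (vol n')
  end.

Lemma vol_prod n (A : 'I_n -> set R) : (forall i, measurable (A i)) ->
  vol n [set x | forall i, A i (tnth x i)] =
  (\prod_(i < n) lebesgue_measure (A i))%E.
Proof.
elim: n A => [|n IHn] A mA.
  rewrite big_ord0 /= (_ : [set _ | _] = setT) ?diracT//.
  by apply/seteqP; split=> // x _ [].
rewrite big_ord_recl -(IHn (fun i => A (lift ord0 i)))//=.
rewrite /lebesgue_step /pushforward -product_measure1E//.
  congr ((_ \x _)%E _); apply/seteqP; split=> -[x t] /=.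
    by move=> At; split=> [|i]; [exact: (At ord0)|rewrite -(tnthS x); exact: At].
  by move=> [Ax At] i; case: (unliftP ord0 i) => [j|] ->; rewrite ?tnthS.
  exact: mA.
have -> : [set x : n.-tuple R | forall i, A (lift ord0 i) (tnth x i)] =
    \bigcap_(i in [set: 'I_n]) ((@tnth n R)^~ i @^-1` A (lift ord0 i)).
  by apply/seteqP; split=> x /= Ax i => [_|]; exact: Ax.
apply: fin_bigcap_measurable => // i _.
by rewrite -[X in measurable X]setTI; exact: measurable_tnth.
Qed.

End LebesgueMeasureTuple.

Section Clipping.
Context {R : realType} {n m : nat}.
Variables (A : 'M[R]_(n, m.+1)) (r : 'rV[R]_m.+1).
Implicit Types (v x : n.-tuple R) (i : 'I_m.+1) (I K : {set 'I_m.+1}).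
Implicit Types (J : {set 'I_n}).

Definition affine i x : R := \sum_(j < n) A j i * tnth x j + r 0 i.

Definition hyperplane i : set (n.-tuple R) := [set x | affine i x = 0].

Definition halfspace i : set (n.-tuple R) := [set x | 0 <= affine i x].

Definition polyhedron : set (n.-tuple R) := \bigcap_(i in setT) halfspace i.

(* H_I, used for I not containing ord_max. *)
Definition flat I : set (n.-tuple R) :=
  ((\bigcap_(i in [set` I]) hyperplane i) `&` polyhedron)
    `\` hyperplane ord_max.

Definition cube : set (n.-tuple R) := [set x | forall j, 0 <= tnth x j <= 1].

Definition zeros v : {set 'I_n} := [set j | tnth v j == 0]%SET.
Definition ones v : {set 'I_n} := [set j | tnth v j == 1]%SET.
Definition stars v : {set 'I_n} :=
  [set j | (tnth v j != 0) && (tnth v j != 1)]%SET.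
Definition bullets v : {set 'I_n} := (zeros v :|: ones v)%SET.

(* F^d; the index is an integer so that F^{-1} is empty. *)
Definition skeleton (d : int) : set (n.-tuple R) :=
  [set v | cube v /\ (#|stars v|)%:Z = d].

(* A_J^K, meaningful when #|J| = #|K|: enum lists a set of ordinals in
   increasing order, and the default ord0 is then never reached.  The empty
   minor is 1. *)
Definition minor J K : R :=
  \det (\matrix_(i < #|J|, j < #|J|)
          A (enum_val i) (nth ord0 (enum K) j)).

Definition minors_prod I v : R :=
  (\prod_(t in I) minor (stars v) (ord_max |: (I :\ t))%SET) *
  \prod_(t in bullets v) minor (t |: stars v)%SET (ord_max |: I)%SET.

Definition good_clipping : Prop :=
  (forall I, ord_max \notin I ->
     skeleton (#|I|%:Z - 1) `&` flat I = set0) /\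
  (forall I, ord_max \notin I ->
     forall v, (skeleton #|I|%:Z `&` flat I) v -> minors_prod I v != 0).

(* Coordinates are numbered from 1 in the sign, hence j.+1. *)
Definition vertex_term I v : R :=
  (-1) ^+ (#|zeros v| + \sum_(j in stars v) j.+1)%N
    * (affine ord_max v * minor (stars v) I) ^+ n
  / (n`!%:R * `|minor (stars v) I| * minors_prod I v).

End Clipping.

(* Main.v *)
Require Import Defs.
From mathcomp Require Import all_boot all_order all_algebra.
From mathcomp Require Import perm boolp reals.
From mathcomp Require Import ring lra zify.

(** The formula is Lawrence's volume formula for the polytope [P] cut out by
    the cube and the half-spaces, with the last function [g] as objective.

    A vertex [v] of [P] with [0 < g v] lies on exactly [n] walls, and the
    [n] edges of the cone of [v] can be reversed, if necessary, so that [g]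
    decreases along all of them.  For almost every point [x] with [0 < g x],
    the signed number of flipped cones that contain [x], counted with sign
    -1 to the number of reversed edges, is 1 if [x] is in [P] and 0 otherwise
    ([vertex_expansion]).  The proof is an induction over the flats cut out by
    the constraints.  Shoot a generic ray from [x] along which [g] increases;
    the indicator of any polyhedron that the ray eventually leaves is the number
    of its exits minus the number of its entries ([inside_exits_entries]), and
    these happen in hyperplanes, where the induction hypothesis applies.  This
    is used for [P] and for each of the flipped cones, and the two sums agree.
    Only the vertices with [0 < g v] enter the count, as the flipped cones of
    the others lie in [g <= 0].

    The part of a flipped cone in [0 <= g] is a simplex, the preimage of the
    standard simplex of size [g v] under the affine map whose coordinates are
    the slacks multiplied by minus the slopes of [g] along the edges
    ([coneE]).  As Lebesgue measure is multiplied by the inverse of the absolute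
    value of the determinant under such preimages ([affmap_scales_vol]) and the
    standard simplex of size [c] has volume [c ^+ n / n`!] ([vol_simplex]),
    integrating the identity between indicators gives the volume as a sum over
    the vertices ([vol_vertices]).

    The determinant of the normals of the walls through [v] is, up to sign, the
    minor of the stars of [v] and the half-spaces tight at [v]
    ([minor_padded]), and Cramer's rule makes
    each slope of [g] a quotient of two minors, up to a sign that counts column
    exchanges ([minor_exchange_slope]).  The product of these signs is the sign
    in the formula ([prod_signed_slopes]).

    The first good clipping condition gives that at most as many half-spaces
    are tight at a point of [P] off the last hyperplane as it has stars
    ([card_tight_affine]), so that the vertices are simple; the second one that
    no slope vanishes ([slope_neq0]).  A term of the formula that does not come
    from a vertex has a vanishing minor in the numerator ([vertex_of_term]). *)

Set Implicit Arguments.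
Unset Strict Implicit.
Unset Printing Implicit Defensive.

Import Order.TTheory GRing.Theory Num.Theory.
Local Open Scope ring_scope.

(** * A ray against a polyhedron *)

Section Line.
Variables (R : realFieldType) (N : finType) (p q : N -> R).

(** [p s + tau * q s] is the value of the [s]-th constraint at time [tau]. *)
Definition inside (tau : R) := [forall s, 0 <= p s + tau * q s].
Definition hit (s : N) : R := - p s / q s.

Lemma hit0 s : q s != 0 -> p s + hit s * q s = 0.
Proof. by move=> q0; rewrite /hit mulfVK// addrN. Qed.

Lemma hitK s : q s != 0 -> hit s * q s = - p s.
Proof. by move=> q0; rewrite /hit mulfVK. Qed.

Lemma inside_le_exit tau s : inside tau -> q s < 0 -> tau <= hit s.
Proof.
move=> /forallP/(_ s) Qs qs.
by rewrite -(ler_nM2r qs) hitK ?lt_eqF// -subr_ge0 opprK addrC.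
Qed.

Lemma entry_le_inside tau s : inside tau -> 0 < q s -> hit s <= tau.
Proof.
move=> /forallP/(_ s) Qs qs.
by rewrite -(ler_pM2r qs) hitK ?gt_eqF// -subr_ge0 opprK addrC.
Qed.

Hypothesis ray_leaves : exists s, q s < 0.
Hypothesis off_start : forall s, q s != 0 -> p s != 0.
Hypothesis no_tie : forall s t, 0 < hit s -> inside (hit s) ->
  t != s -> q t != 0 -> p t + hit s * q t != 0.

Let no_tie_eq s t : 0 < hit s -> inside (hit s) -> q t != 0 ->
  hit s = hit t -> t = s.
Proof.
move=> hs Qs qt est; apply: contra_eq est => ts.
by apply: contra_neq (no_tie hs Qs ts qt) => ->; rewrite hit0.
Qed.

Let exits s := [&& 0 < hit s, q s < 0 & inside (hit s)].
Let enters s := [&& 0 < hit s, 0 < q s & inside (hit s)].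

Let exists_exit tau : 0 <= tau -> inside tau -> exists s, exits s.
Proof.
move=> tau0 Qtau; have [s0 qs0] := ray_leaves.
have [e qe emin] := @arg_minP _ R _ s0 (fun s => q s < 0) hit qs0.
exists e; have te := inside_le_exit Qtau qe.
rewrite /exits qe /=; apply/andP; split.
  have qe0 : q e != 0 by rewrite lt_eqF.
  by rewrite lt_def (le_trans tau0 te) andbT mulf_eq0 oppr_eq0 invr_eq0
    negb_or off_start.
apply/forallP => s; have [qs|qs|qs] := ltgtP (q s) 0.
- have : hit s * q s <= hit e * q s by rewrite ler_nM2r//; exact: emin.
  by rewrite hitK ?lt_eqF//; lra.
- have /forallP/(_ s) := Qtau.
  by have := te; rewrite -(ler_pM2r qs); lra.
- by have /forallP/(_ s) := Qtau; rewrite qs !mulr0.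
Qed.

(** The set of times spent inside is an interval, bounded above because the ray
    leaves.  Without ties it is entered through at most one wall and left
    through exactly one, if it is met at all; the ray starts inside iff there is
    an exit that no entry precedes.  The condition [0 < hit s] also discards the
    constraints with [q s = 0], for which [hit s = 0]. *)
Lemma inside_exits_entries :
  (inside 0)%:R = - \sum_(s | 0 < hit s) Num.sg (q s) * (inside (hit s))%:R :> R.
Proof.
have sumE (c : pred N) : (forall s t, c s -> c t -> s = t) ->
    \sum_(s | c s) 1 = [exists s, c s]%:R :> R.
  move=> cu; case: existsP => [[s cs]|nc].
    by rewrite (big_pred1 s)// => t; apply/idP/eqP => [ct|->//]; exact: cu.
  by rewrite big_pred0// => s; apply/negP => cs; apply: nc; exists s.
have -> : \sum_(s | 0 < hit s) Num.sg (q s) * (inside (hit s))%:R =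
    [exists s, enters s]%:R - [exists s, exits s]%:R :> R.
  rewrite -sumE; last first.
    move=> s t /and3P[hs qs Qs] /and3P[ht qt Qt].
    apply/esym/no_tie_eq => //; first by rewrite gt_eqF.
    by apply: le_anti; rewrite !entry_le_inside.
  rewrite -sumE; last first.
    move=> s t /and3P[hs qs Qs] /and3P[ht qt Qt].
    apply/esym/no_tie_eq => //; first by rewrite lt_eqF.
    by apply: le_anti; rewrite !inside_le_exit.
  rewrite big_mkcond [X in _ = X - _]big_mkcond [X in _ = _ - X]big_mkcond /=.
  rewrite -sumrB; apply: eq_bigr => s _; rewrite /enters /exits.
  case: (ltP 0 (hit s)) => hs /=; last by rewrite subrr.
  case: (inside _) => /=; rewrite !(andbT, andbF) ?mulr0 ?subrr// mulr1.
  have [qs|qs|qs] := ltgtP (q s) 0.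
  - by rewrite ltr0_sg// sub0r.
  - by rewrite gtr0_sg// subr0.
  - by rewrite qs sgr0 subrr.
have [/existsP[e /and3P[he qe Qe]]|/existsPn noexit] := boolP [exists s, exits s].
  have [Q0|nQ0] := boolP (inside 0).
    case: existsP => [[f /and3P[hf qf Qf]]|_]; last by rewrite sub0r opprK.
    by have := entry_le_inside Q0 qf; rewrite leNgt hf.
  (* There is an exit but the start is outside: the last entry comes before
     the exit. *)
  suff -> : [exists s, enters s] by rewrite subrr oppr0.
  move: nQ0; rewrite negb_forall => /existsP[s]; rewrite mul0r addr0 -ltNge => ps.
  have qs : 0 < q s by move/forallP/(_ s) : (Qe); rewrite -(pmulr_rgt0 _ he); lra.
  have [f qf fmax] := @arg_maxP _ R _ s (fun s => 0 < q s) hit qs.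
  apply/existsP; exists f; apply/and3P; split => //.
    apply: lt_le_trans (fmax _ qs).
    by rewrite /hit divr_gt0// oppr_gt0.
  have fe := entry_le_inside Qe qf.
  apply/forallP => t; have [qt|qt|qt] := ltgtP (q t) 0.
  - have /forallP/(_ t) := Qe.
    by have := fe; rewrite -(ler_nM2r qt); lra.
  - have : hit t * q t <= hit f * q t by rewrite ler_pM2r//; exact: fmax.
    by rewrite hitK ?gt_eqF//; lra.
  - by have /forallP/(_ t) := Qe; rewrite qt !mulr0.
have noin tau : 0 <= tau -> inside tau = false.
  move=> t0; apply/negP => /(exists_exit t0)[s es].
  by have := noexit s; rewrite es.
rewrite noin// (_ : [exists s, enters s] = false) ?subrr ?oppr0//.
apply/negbTE/existsPn => s; apply/negP => /and3P[hs _].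
by rewrite noin// ltW.
Qed.

End Line.

(** * Generic directions *)

Section Generic.
Variables (R : realFieldType) (V : lmodType R) (D : V -> Prop).
Hypothesis D_closed : forall a u v, D u -> D v -> D (a *: u + v).
Hypothesis D0 : D 0.

Lemma avoid (s : seq R) : exists x, x \notin s.
Proof.
exists (1 + \sum_(y <- s) `|y|).
apply/negP => xs; have : \sum_(y <- s) `|y| >= 1 + \sum_(y <- s) `|y|.
  rewrite {2}(big_rem _ xs)/= (le_trans (ler_norm _))// lerDl.
  by rewrite big_seq sumr_ge0.
lra.
Qed.

(** A vector space over an infinite field is not a finite union of proper
    subspaces: if [d] serves the functionals treated so far and [e] serves the
    next one, then [eps *: e + d] serves them all for all but finitely many
    [eps]. *)
Lemma generic_direction (I : finType) (f : I -> V -> R) :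
  (forall i a u v, f i (a *: u + v) = a * f i u + f i v) ->
  exists2 d, D d & forall i, (exists2 e, D e & f i e != 0) -> f i d != 0.
Proof.
move=> f_lin.
suff [d Dd dP] : exists2 d, D d &
    forall i, i \in enum I -> (exists2 e, D e & f i e != 0) -> f i d != 0.
  by exists d => // i; apply: dP; rewrite mem_enum.
elim: (enum I) => [|i s [d Dd dP]]; first by exists 0.
have [[e De fe]|noe] := pselect (exists2 e, D e & f i e != 0); last first.
  by exists d => // j; rewrite inE => /predU1P[-> //|]; exact: dP.
have [eps] := avoid (0 :: [seq - f j d / f j e | j <- i :: s]).
rewrite inE negb_or => /andP[eps0 epsP].
exists (eps *: e + d); first exact: D_closed.
move=> j js wj; rewrite f_lin.
have [fje|fje] := eqVneq (f j e) 0.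
  rewrite fje mulr0 add0r; apply: dP => //; move: js; rewrite inE.
  by case/predU1P => // ji; move: fe; rewrite -ji fje eqxx.
apply: contraNneq epsP => E.
have -> : eps = - f j d / f j e by apply: (mulIf fje); rewrite mulfVK//; lra.
by apply/mapP; exists j.
Qed.

End Generic.

(** * Expansion of a polyhedron into flipped cones *)

Section Flip.
Variable R : realFieldType.

(** Contribution of an edge with slope [c] to the flipped cone, where [a] is the
    coordinate of the point along that edge: the objective must be smaller at
    the point than at the vertex, and reversed edges count negatively. *)
Definition flip_sign (c a : R) : R := (c * a < 0)%R%:R * Num.sg a.

Lemma flip_signE c a : c != 0 -> a != 0 ->
  flip_sign c a = - Num.sg c * (0 <= - Num.sg c * a)%R%:R.
Proof.
rewrite /flip_sign; move=> c0 a0.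
have [cl|cl|/eqP] := ltgtP c 0; last by rewrite (negbTE c0).
  rewrite (ltr0_sg cl) opprK !mul1r nmulr_rlt0//.
  by case: ltgtP a0 => // al _; rewrite ?mul0r// gtr0_sg// mulr1.
rewrite (gtr0_sg cl) pmulr_rlt0// !mulN1r oppr_ge0.
by case: ltgtP a0 => // al _; rewrite ?mul0r ?oppr0 ?ltr0_sg// mul1r.
Qed.

Lemma prod_bool (N : finType) (P Q : pred N) :
  \prod_(t | P t) (Q t)%:R = [forall (t | P t), Q t]%:R :> R.
Proof.
have [/forall_inP PQ|/forall_inPn[t Pt nQt]] := boolP [forall (t | P t), Q t].
  by rewrite big1// => t Pt; rewrite PQ.
by rewrite (bigD1 t)//= (negbTE nQt) mul0r.
Qed.

(** A product of contributions is the indicator of the flipped cone, an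
    intersection of half-spaces, up to a global sign.  Away from the walls it
    does not matter whether inequalities are strict. *)
Lemma prod_flip_sign (N : finType) (F : {set N}) (c a : N -> R) :
  (forall t, t \in F -> c t != 0) -> (forall t, t \in F -> a t != 0) ->
  \prod_(t in F) flip_sign (c t) (a t) =
  \prod_(t in F) - Num.sg (c t) * [forall t in F, 0 <= - Num.sg (c t) * a t]%R%:R.
Proof.
move=> c0 a0; rewrite -prod_bool -big_split; apply: eq_bigr => t tF.
by rewrite flip_signE ?c0 ?a0.
Qed.

End Flip.

Section Lawrence.
Variables (R : realFieldType) (V : lmodType R) (N : finType).
Variables (l : N -> V -> R) (b : N -> R) (k : V -> R) (k0 : R).
Hypothesis l_lin : forall t a u v, l t (a *: u + v) = a * l t u + l t v.
Hypothesis k_lin : forall a u v, k (a *: u + v) = a * k u + k v.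
Implicit Types (S T : {set N}) (s t : N) (x d v : V).

Definition slack t x := l t x + b t.
Definition objective x := k x + k0.
Definition feasible x := [forall t, 0 <= slack t x].
Definition tight x := [set t | slack t x == 0].
Definition along S d := [forall s in S, l s d == 0].
(** The directions of the flat cut out by [S] are those [along S]; the
    constraints in [S] pin a point when this flat is reduced to it. *)
Definition pins S := forall d, along S d -> d = 0.
Definition is_vertex x := [/\ feasible x, 0 < objective x & pins (tight x)].

(* A vertex is represented by the set [T] of its tight constraints: [p T] is the
   vertex, and [e T t] the direction of the edge that leaves the wall of [t]. *)
Variables (VT : {set {set N}}) (p : {set N} -> V) (e : {set N} -> N -> V).

Hypothesis bounded : forall d, d != 0 -> exists s, l s d < 0.
Hypothesis p_vertex : forall T, T \in VT -> is_vertex (p T) /\ tight (p T) = T.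
Hypothesis tight_vertex : forall x, is_vertex x -> tight x \in VT.
Hypothesis dual : forall T s t, T \in VT -> s \in T -> t \in T ->
  l s (e T t) = (s == t)%:R.
Hypothesis edge : forall T t, T \in VT -> t \in T -> k (e T t) != 0.

Lemma l0 t : l t 0 = 0.
Proof. by have := l_lin t 1 0 0; rewrite scale1r addr0; lra. Qed.

Lemma slackD t x a d : slack t (a *: d + x) = slack t x + a * l t d.
Proof. by rewrite /slack l_lin; ring. Qed.

Lemma along_closed S a u v : along S u -> along S v -> along S (a *: u + v).
Proof.
move=> /forall_inP hu /forall_inP hv; apply/forall_inP => s sS.
by rewrite l_lin (eqP (hu _ sS)) (eqP (hv _ sS)) mulr0 addr0.
Qed.

Lemma along0 S : along S 0.
Proof. by apply/forall_inP => s _; rewrite l0. Qed.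

Lemma alongU S s d : along (s |: S) d = (l s d == 0) && along S d.
Proof.
apply/forall_inP/andP => [h|[ls /forall_inP h] t].
  split; first by rewrite h// setU11.
  by apply/forall_inP => t tS; rewrite h// setU1r.
by rewrite in_setU1 => /predU1P[->//|]; exact: h.
Qed.

Lemma along_edge T S t : T \in VT -> S \subset T -> t \in T -> t \notin S ->
  along S (e T t).
Proof.
move=> TV ST tT tS; apply/forall_inP => s sS.
have /negbTE st : s != t by apply: contraNneq tS => <-.
by rewrite dual// ?(subsetP ST)// st.
Qed.

(** The constraint [t] is not constant on the flat cut out by [S]. *)
Definition varies S t := `[< exists2 d, along S d & l t d != 0 >].

Lemma varies_edge T S t : T \in VT -> S \subset T -> t \in T -> t \notin S ->
  varies S t.
Proof.
move=> TV ST tT tS; apply/asboolP; exists (e T t); first exact: along_edge.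
by rewrite dual// eqxx oner_eq0.
Qed.

Lemma variesPn S t d : ~~ varies S t -> along S d -> l t d = 0.
Proof.
by move=> nv hd; apply/eqP; apply: contraNT nv => ltd; apply/asboolP; exists d.
Qed.

Lemma varies_notin S t : varies S t -> t \notin S.
Proof.
move=> /asboolP[d /forall_inP hd ltd]; apply: contra ltd; exact: hd.
Qed.

(** The slopes along the edges are the coordinates of the objective in the basis
    of the constraints tight at the vertex. *)
Lemma objective_edge T d : T \in VT -> k d = \sum_(t in T) k (e T t) * l t d.
Proof.
move=> TV; have [[_ _ pinned] tT] := p_vertex TV.
have ksum (I : seq N) (c : N -> R) (u : N -> V) :
    (forall s, l s (\sum_(t <- I) c t *: u t) = \sum_(t <- I) c t * l s (u t)) /\
    k (\sum_(t <- I) c t *: u t) = \sum_(t <- I) c t * k (u t).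
  have kz : k 0 = 0 by have := k_lin 1 0 0; rewrite scale1r addr0; lra.
  elim: I => [|i I [IH1 IH2]].
    by rewrite !big_nil; split => // s; rewrite big_nil l0.
  by split => [s|]; rewrite !big_cons ?l_lin ?k_lin ?IH1 ?IH2.
pose w := \sum_(t <- enum T) l t d *: e T t.
have : d - w = 0.
  apply: pinned; rewrite tT; apply/forall_inP => s sT.
  have -> : d - w = (-1) *: w + d by rewrite scaleN1r addrC.
  rewrite l_lin (ksum _ _ _).1 big_enum /= (bigD1 s)//= dual// eqxx mulr1.
  rewrite big1 ?addr0; first by rewrite mulN1r addNr.
  by move=> t /andP[tT' ts]; rewrite dual// eq_sym (negbTE ts) mulr0.
move/eqP; rewrite subr_eq0 => /eqP {1}->.
by rewrite (ksum _ _ _).2 big_enum; apply: eq_bigr => t _; rewrite mulrC.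
Qed.

(** Point where the ray from [x] in direction [d] crosses the wall of [s]. *)
Definition foot s x d := hit (slack^~ x) (l^~ d) s *: d + x.

(* One step of the induction: a point [x] of the flat of [S] and a direction
   [d] of that flat along which everything that can vary does. *)
Section Step.
Variables (S : {set N}) (x d : V).
Hypothesis x_S : forall s, s \in S -> slack s x = 0.
Hypothesis x_pos : 0 < objective x.
Hypothesis x_gen : forall t, varies S t -> slack t x != 0.
Hypothesis d_S : along S d.
Hypothesis d_neq0 : d != 0.
Hypothesis d_up : 0 <= k d.
Hypothesis d_gen : forall t, varies S t -> l t d != 0.
Hypothesis d_gen2 : forall s t, varies S s -> varies (s |: S) t ->
  slack t (foot s x d) != 0.
Hypothesis d_up_strict : (exists2 u, along S u & k u != 0) -> 0 < k d.

Let hitd s := hit (slack^~ x) (l^~ d) s.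

Lemma varies_direction s : l s d != 0 -> varies S s.
Proof. by move=> lsd; apply/asboolP; exists d. Qed.

Lemma hit_varies s : 0 < hitd s -> l s d != 0.
Proof.
apply: contraTneq => lsd.
by rewrite /hitd /hit lsd invr0 mulr0 ltxx.
Qed.

Lemma foot_on s : l s d != 0 -> slack s (foot s x d) = 0.
Proof. by move=> lsd; rewrite /foot slackD hit0. Qed.

(** The ray leaves the flipped cone because the objective increases along the
    ray whereas it is bounded above on the cone by its value at the vertex.  So
    the exits and entries can be counted; the constraints that do not
    take part get the zero function. *)
Lemma flipped_cone_line T : T \in VT -> S \subset T ->
  \prod_(t in T :\: S) flip_sign (k (e T t)) (slack t x) =
  - \sum_(s in T :\: S | 0 < hitd s) Num.sg (l s d) *
     \prod_(t in T :\: (s |: S)) flip_sign (k (e T t)) (slack t (foot s x d)).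
Proof.
move=> TV ST.
pose F := T :\: S; pose u t := - Num.sg (k (e T t)).
have FE t : t \in F -> t \in T /\ t \notin S by rewrite in_setD => /andP[].
have Fvar t : t \in F -> varies S t.
  by move=> /FE[tT tS]; exact: varies_edge TV ST tT tS.
have u0 t : t \in F -> u t != 0.
  by move=> /FE[tT _]; rewrite oppr_eq0 sgr_eq0 edge.
have uu t : t \in F -> u t * u t = 1.
  by move=> /FE[tT _]; rewrite mulrNN -expr2 sqr_sg edge.
pose P t := if t \in F then u t * slack t x else 0.
pose Q t := if t \in F then u t * l t d else 0.
have hitE t : hit P Q t = if t \in F then hitd t else 0.
  rewrite /hit /P /Q; case: ifP => tF; last by rewrite oppr0 mul0r.
  by rewrite -mulrN -mulf_div divff ?mul1r ?u0.
have insideE tau :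
    inside P Q tau = [forall t in F, 0 <= u t * slack t (tau *: d + x)].
  apply: eq_forallb => t; rewrite /P /Q; case: ifP => tF /=.
    by rewrite slackD; congr (0 <= _); ring.
  by rewrite mulr0 addr0 lexx.
have kS : F != set0 -> 0 < k d.
  move=> /set0Pn[t tF]; have [tT tS] := FE t tF.
  by apply: d_up_strict; exists (e T t); [exact: along_edge|exact: edge].
have F0 : F != set0.
  apply/eqP => F0.
  have [[_ _ pinned] tightT] := p_vertex TV.
  move/eqP: d_neq0; apply; apply: pinned; rewrite tightT.
  suff -> : T = S by [].
  by apply/eqP; rewrite eqEsubset ST andbT -setD_eq0 -/F F0.
rewrite prod_flip_sign; last 2 first.
- by move=> t /FE[tT _]; exact: edge.
- by move=> t /Fvar; exact: x_gen.
have -> : [forall t in T :\: S, 0 <= - Num.sg (k (e T t)) * slack t x] =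
    inside P Q 0 by rewrite insideE scale0r add0r.
rewrite inside_exits_entries; first last.
- move=> s t; rewrite hitE; case: ifPn => sF; last by rewrite ltxx.
  move=> hs _ ts; rewrite /Q /P; case: ifPn => tF; last by rewrite eqxx.
  move=> _; have -> : u t * slack t x + hitd s * (u t * l t d) =
      u t * slack t (foot s x d) by rewrite /foot slackD /hitd; ring.
  rewrite mulf_neq0 ?u0// d_gen2 ?Fvar//.
  have [tT tS] := FE _ tF; have [sT _] := FE _ sF.
  apply: varies_edge TV _ tT _; last by rewrite in_setU1 negb_or ts.
  by rewrite subUset sub1set sT.
- move=> t; rewrite /Q /P; case: ifPn => tF; last by rewrite eqxx.
  by move=> _; rewrite mulf_neq0 ?u0 ?x_gen ?Fvar.
- apply/existsP; apply: contraPT (kS F0) => /existsPn nq.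
  apply/negP; rewrite -leNgt (objective_edge _ TV).
  rewrite (bigID (mem S)) /= big1 ?add0r; last first.
    move=> t /andP[_ tS]; move/forall_inP: d_S => /(_ _ tS)/eqP ->.
    by rewrite mulr0.
  apply: sumr_le0 => t /andP[tT tS].
  have tF : t \in F by rewrite in_setD tS.
  have := nq t; rewrite /Q tF -leNgt /u mulNr oppr_ge0 => h.
  by rewrite [k _]numEsg mulrAC mulr_le0_ge0.
rewrite mulrN mulr_sumr; congr (- _).
rewrite [in RHS](eq_bigl (fun s => 0 < hit P Q s)); last first.
  by move=> s; rewrite hitE; case: ifP; rewrite //= ltxx.
apply: eq_bigr => s; rewrite hitE; case: ifPn => sF; last by rewrite ltxx.
move=> hs; have [sT sS] := FE _ sF.
have sub : s |: S \subset T by rewrite subUset sub1set sT.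
have FsE t : (t \in T :\: (s |: S)) = (t \in F) && (t != s).
  rewrite !in_setD in_setU1 negb_or.
  by case: (t == s); case: (t \in S); case: (t \in T).
rewrite prod_flip_sign; last 2 first.
- by move=> t; rewrite in_setD => /andP[_ tT]; exact: edge.
- move=> t tF; have := tF; rewrite in_setD => /andP[tsS tT].
  by apply: d_gen2; [exact: Fvar|exact: varies_edge TV sub tT tsS].
rewrite (bigD1 s)//= -/(u s).
rewrite (eq_bigl (fun t => t \in T :\: (s |: S))); last by move=> t; rewrite FsE.
(* The factor of [s] is a sign that squares to one: it cancels against the sign
   by which the flipped constraint of [s] changes the direction of crossing. *)
rewrite /Q sF sgrM.
have -> : Num.sg (u s) = u s.
  by rewrite /u sgrN sgr_id.
have -> : inside P Q (hitd s) =
   [forall t in T :\: (s |: S), 0 <= - Num.sg (k (e T t)) * slack t (foot s x d)].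
  rewrite insideE; apply/forall_inP/forall_inP => h t.
    by rewrite FsE => /andP[tF _]; exact: h.
  move=> tF; have [->|ts] := eqVneq t s; last by apply: h; rewrite FsE tF.
  by rewrite -/(foot s x d) foot_on ?mulr0 ?lexx// hit_varies.
set pr := \prod_(_ in _) _; set bb := _%:R.
transitivity (u s * u s * (Num.sg (l s d) * (pr * bb))); first by ring.
by rewrite uu// mul1r.
Qed.

Lemma feasible_line :
  (forall s, 0 < hitd s -> feasible (foot s x d) ->
     forall t, t != s -> l t d != 0 -> slack t (foot s x d) != 0) ->
  (feasible x)%:R =
  - \sum_(s | 0 < hitd s) Num.sg (l s d) * (feasible (foot s x d))%:R :> R.
Proof.
move=> notie.
have insideE tau : inside (slack^~ x) (l^~ d) tau = feasible (tau *: d + x).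
  by apply: eq_forallb => t; rewrite slackD.
have -> : feasible x = inside (slack^~ x) (l^~ d) 0.
  by rewrite insideE scale0r add0r.
rewrite inside_exits_entries.
- by congr (- _); apply: eq_bigr => s _; rewrite insideE.
- exact: bounded.
- by move=> s /varies_direction; exact: x_gen.
- move=> s t hs; rewrite insideE => fs ts lt.
  by have := notie s hs fs t ts lt; rewrite /foot slackD.
Qed.

End Step.

(** When the flat is a point, that point is feasible iff it is a vertex, and
    then [S] is the whole set of its tight constraints: a further one would have
    an edge along the flat. *)
Lemma pinned_expansion S x : pins S ->
  (forall s, s \in S -> slack s x = 0) -> 0 < objective x ->
  (feasible x)%:R = \sum_(T in VT | S \subset T)
     \prod_(t in T :\: S) flip_sign (k (e T t)) (slack t x).
Proof.
move=> pinS x_S x_pos.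
have VTS T : T \in VT -> S \subset T -> p T = x /\ T = S.
  move=> TV ST; have [_ tT] := p_vertex TV.
  split; last first.
    apply/eqP; rewrite eqEsubset ST andbT; apply/subsetP => t tT'.
    apply: contraT => tS.
    have e0 := pinS _ (along_edge TV ST tT' tS).
    by have := dual TV tT' tT'; rewrite e0 l0 eqxx => /esym/eqP; rewrite oner_eq0.
  apply/eqP; rewrite -subr_eq0; apply/eqP/pinS.
  apply/forall_inP => s sS; rewrite addrC -scaleN1r l_lin.
  have : slack s (p T) = 0.
    by apply/eqP; have := subsetP ST _ sS; rewrite -{1}tT inE.
  by have := x_S s sS; rewrite /slack => ? ?; apply/eqP; lra.
have [fx|nfx] := boolP (feasible x); last first.
  rewrite big_pred0// => T; apply/negP => /andP[TV ST].
  have [px _] := VTS _ TV ST; have [[fT _ _] _] := p_vertex TV.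
  by move: nfx; rewrite -px fT.
have TV : tight x \in VT.
  apply: tight_vertex; split => // d hd; apply: pinS; apply/forall_inP => s sS.
  by move/forall_inP: hd; apply; rewrite inE x_S.
have [|_ ES] := VTS _ TV; first by apply/subsetP => s sS; rewrite inE x_S.
rewrite (big_pred1 S) ?setDv ?big_set0// => T /=.
apply/idP/eqP => [/andP[T1 T2]|->]; first exact: (VTS _ T1 T2).2.
by rewrite -{1}ES TV subxx.
Qed.

(** The three families of functionals that the direction of the ray has to
    avoid are the slacks, the objective, and, for two constraints [s] and [t],
    a multiple of the slack of [t] where the ray meets the wall of [s]. *)
Lemma exists_direction S x : ~ pins S ->
  (forall t, varies S t -> slack t x != 0) ->
  exists d, [/\ along S d, d != 0, 0 <= k d,
    (exists2 u, along S u & k u != 0) -> 0 < k d &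
    (forall t, varies S t -> l t d != 0) /\
    (forall s t, varies S s -> varies (s |: S) t -> slack t (foot s x d) != 0)].
Proof.
move=> nS x_gen.
have [u hu u0] : exists2 u, along S u & u != 0.
  apply: contrapT => nu; apply: nS => d hd; apply/eqP; apply: contrapT.
  by move=> /negP d0; apply: nu; exists d.
pose f (i : N + (N * N + unit)) d : R := match i with
  | inl t => l t d
  | inr (inl (s, t)) => slack t x * l s d - slack s x * l t d
  | inr (inr tt) => k d end.
have f_lin i a v w : f i (a *: v + w) = a * f i v + f i w.
  by case: i => [t|[[s t]|[]]] /=; rewrite ?l_lin ?k_lin; ring.
have [d hd d_gen] := generic_direction (@along_closed S) (along0 S) f_lin.
have d_l t : varies S t -> l t d != 0 by move=> /asboolP; exact: (d_gen (inl t)).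
have d_ll s t : varies S s -> varies (s |: S) t ->
    slack t x * l s d - slack s x * l t d != 0.
  move=> vs /asboolP[v]; rewrite alongU => /andP[/eqP lsv hv ltv].
  apply: (d_gen (inr (inl (s, t)))); exists v => //=.
  by rewrite lsv mulr0 add0r oppr_eq0 mulf_neq0// x_gen.
have d_k : (exists2 u, along S u & k u != 0) -> k d != 0.
  exact: (d_gen (inr (inr tt))).
have d0 : d != 0.
  have [s ls] := bounded u0.
  have /d_l : varies S s by apply/asboolP; exists u; rewrite ?lt_eqF.
  by apply: contraNneq => ->; rewrite l0.
clear d_gen.
wlog kd : d hd d_l d_ll d_k d0 / 0 <= k d.
  move=> W; have [kd|kd] := leP 0 (k d); first exact: (W d).
  have lN t : l t (- d) = - l t d.
    by have := l_lin t (-1) d 0; rewrite addr0 scaleN1r l0; lra.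
  have kN : k (- d) = - k d.
    have := k_lin (-1) d 0; have := k_lin 1 0 0.
    by rewrite scale1r !addr0 scaleN1r; lra.
  apply: (W (- d)).
  - by apply/forall_inP => s sS; rewrite lN oppr_eq0; move/forall_inP: hd; apply.
  - by move=> t vt; rewrite lN oppr_eq0 d_l.
  - move=> s t vs vt; have := d_ll s t vs vt; apply: contra_neq; rewrite !lN; lra.
  - by move=> /d_k; rewrite kN oppr_eq0.
  - by rewrite oppr_eq0.
  - by rewrite kN oppr_ge0 ltW.
exists d; split => //; first by move=> /d_k; rewrite lt_def kd andbT.
split => // s t vs vt; have := d_ll s t vs vt; apply: contra_neq.
rewrite /foot slackD /hit => E; have lsd := d_l _ vs.
by rewrite -(mulr0 (l s d)) -E; field.
Qed.

(** The expansion for the points of a flat, by induction on the number of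
    constraints that vary on it.  A generic ray from [x] along which the
    objective increases crosses the polyhedron and each flipped cone at points
    of smaller flats, and both indicators are the same signed sums over these
    crossings. *)
Theorem vertex_expansion S x :
  (forall s, s \in S -> slack s x = 0) -> 0 < objective x ->
  (forall t, varies S t -> slack t x != 0) ->
  (feasible x)%:R = \sum_(T in VT | S \subset T)
     \prod_(t in T :\: S) flip_sign (k (e T t)) (slack t x).
Proof.
have [c] := ubnP #|[set t | varies S t]|; elim: c => // c IH in S x *.
move=> leS x_S x_pos x_gen.
have [pinS|nS] := pselect (pins S); first exact: pinned_expansion.
have [d [hd d0 kd0 kd [d_l d_ll]]] := exists_direction nS x_gen.
pose hitd s := hit (slack^~ x) (l^~ d) s.
have hv s : 0 < hitd s -> varies S s.
  by move=> /hit_varies; exact: varies_direction.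
have foot_S s r : varies S s -> r \in s |: S -> slack r (foot s x d) = 0.
  move=> vs; rewrite in_setU1 => /predU1P[->|rS]; first exact/foot_on/d_l.
  rewrite /foot slackD x_S//; move/forall_inP: hd => /(_ _ rS)/eqP ->.
  by rewrite mulr0 addr0.
have IHs s : 0 < hitd s -> (feasible (foot s x d))%:R =
    \sum_(T in VT | s |: S \subset T)
      \prod_(t in T :\: (s |: S)) flip_sign (k (e T t)) (slack t (foot s x d)).
  move=> hs; have vs := hv _ hs; apply: IH.
  - rewrite -ltnS; apply: leq_ltn_trans leS; apply: proper_card; apply/properP.
    split; last first.
      by exists s; rewrite ?inE//; apply/negP => /varies_notin; rewrite setU11.
    apply/subsetP => t; rewrite !inE => /asboolP[v].
    by rewrite alongU => /andP[_ hv' lv]; apply/asboolP; exists v.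
  - by move=> r; exact: foot_S.
  - rewrite /objective /foot k_lin -addrA; apply: ltr_wpDl => //.
    by rewrite mulr_ge0// ltW.
  - by move=> t; exact: d_ll.
rewrite (@feasible_line S x d)//; last first.
  move=> s hs fs t ts ltd; have vs := hv _ hs.
  have [vt|nvt] := boolP (varies (s |: S) t); first exact: d_ll.
  apply/eqP => tie.
  (* Now [t] vanishes on the whole flat of [s |: S], so it is tight at every
     vertex of that flat although it is not independent of [s |: S]: there is
     no such vertex, and the induction hypothesis says that the foot is not
     feasible. *)
  have := IHs s hs; rewrite fs big_pred0; first by move/eqP; rewrite oner_eq0.
  move=> T; apply/negP => /andP[TV sST].
  have [_ tightT] := p_vertex TV.
  have pE : p T = 1 *: (p T - foot s x d) + foot s x d by rewrite scale1r subrK.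
  have al : along (s |: S) (p T - foot s x d).
    apply/forall_inP => r rS; have : slack r (p T) = 0.
      by apply/eqP; have := subsetP sST _ rS; rewrite -{1}tightT inE.
    by rewrite {1}pE slackD foot_S// add0r mul1r => ->.
  have tT : t \in T.
    by rewrite -tightT inE {1}pE slackD tie add0r mul1r (variesPn nvt al).
  move/negP: nvt; apply; apply: varies_edge TV sST tT _.
  by rewrite in_setU1 negb_or ts varies_notin//; apply/asboolP; exists d.
under eq_bigr => s hs do rewrite IHs// mulr_sumr.
under [in RHS]eq_bigr => T /andP[TV ST] do rewrite (@flipped_cone_line S x d)//.
rewrite [in RHS]sumrN; congr (- _).
rewrite (exchange_big_dep (fun T => (T \in VT) && (S \subset T)))/=; last first.
  by move=> s T _ /andP[-> /=]; rewrite subUset => /andP[].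
apply: eq_bigr => T /andP[TV ST]; apply: eq_bigl => s.
rewrite TV subUset sub1set ST andbT /= in_setD andbC.
case: (boolP (0 < _)) => hs; rewrite ?andbF//= !andbT.
by rewrite (varies_notin (hv _ hs)).
Qed.

End Lawrence.

(** * Ranks in sets of ordinals *)

Section Enum.

Lemma enum_ord_sorted n (J : {set 'I_n}) :
  sorted (fun i j : 'I_n => (i < j)%N) (enum J).
Proof.
rewrite /enum_mem; apply: sorted_filter; first by move=> ? ? ?; exact: ltn_trans.
by have := iota_ltn_sorted 0 n; rewrite -val_enum_ord sorted_map enumT.
Qed.

Lemma index_enum_set n (J : {set 'I_n}) (j : 'I_n) : j \in J ->
  index j (enum J) = #|[set s in J | (s < j)%N]|.
Proof.
rewrite -mem_enum => jJ.
have -> : #|[set s in J | (s < j)%N]| = count (fun s : 'I_n => (s < j)%N) (enum J).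
  rewrite -size_filter cardE /enum_mem -filter_predI; congr size.
  by apply: eq_filter => s /=; rewrite !inE andbC.
have := enum_ord_sorted J; elim: (enum J) jJ => //= x s IH jxs xs.
have lts : transitive (fun i j : 'I_n => (i < j)%N).
  by move=> ? ? ?; exact: ltn_trans.
have /allP xmin := order_path_min lts xs.
move: jxs; rewrite inE eq_sym; case: eqVneq => [<- _|xj /= js].
  rewrite ltnn add0n; apply/esym/eqP; rewrite eqn0Ngt -has_count.
  by apply/hasPn => y /xmin /=; rewrite -leqNgt => /ltnW.
by rewrite (IH js (path_sorted xs)) (xmin _ js).
Qed.

Lemma nth_enum_setD1 n (J : {set 'I_n}) (j x0 : 'I_n) k : j \in J ->
  nth x0 (enum (J :\ j)) k = nth x0 (enum J) (bump (index j (enum J)) k).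
Proof.
move=> jJ.
have -> : enum (J :\ j) = rem j (enum J).
  rewrite rem_filter ?enum_uniq// /enum_mem -filter_predI.
  by apply: eq_filter => s; rewrite !inE.
rewrite remE; set p := index _ _.
have pJ : (p < size (enum J))%N by rewrite index_mem mem_enum.
rewrite nth_cat size_take pJ /bump; case: ltnP => kp; first by rewrite nth_take.
by rewrite nth_drop add1n addSn subnKC.
Qed.

Lemma enum_ord_max m (I : {set 'I_m.+1}) : ord_max \notin I ->
  enum (ord_max |: I)%SET = rcons (enum I) ord_max.
Proof.
move=> mI; rewrite /enum_mem -!enumT enum_ordSr !filter_rcons /=.
rewrite setU11 (negbTE mI); congr rcons; apply: eq_in_filter => i.
move=> /mapP[k _ ->]; rewrite /= !inE -val_eqE /= ltn_eqF//.
Qed.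

End Enum.

(** * Determinants with unit columns or one replaced column *)

Section Determinants.
Variable R : comNzRingType.

(** Expand along the unit columns one after the other; as they sit on the
    diagonal, no sign appears. *)
Lemma det_principal k n (f : 'I_k -> 'I_n) (M : 'M[R]_n) : injective f ->
  (forall j, j \notin codom f -> forall i, M i j = (i == j)%:R) ->
  \det M = \det (mxsub f f M).
Proof.
elim: n => [|n IH] in f M *; move=> finj Mf.
  have k0 : k = 0%N by case: k f {finj Mf} => // k f; case: (f ord0).
  by subst k; rewrite !det_mx00.
case: (pickP [pred j | j \notin codom f]) => [t /= tf|all_f]; last first.
  have cf j : j \in codom f by have := all_f j => /= /negbFE.
  have kn : k = n.+1.
    have := card_codom finj; rewrite !card_ord => <-.
    by rewrite -[RHS](card_ord n.+1); apply: eq_card => j; rewrite cf.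
  subst k; set ps := perm finj.
  have -> : mxsub f f M = perm_mx ps *m (M *m perm_mx ps^-1).
    by rewrite -row_permE -col_permE; apply/matrixP => i j; rewrite !mxE !permE.
  rewrite !det_mulmx !det_perm odd_permV mulrCA -signr_addb addbb.
  by rewrite mulr1.
have [f' f'E] : exists f' : 'I_k -> 'I_n, forall i, f i = lift t (f' i).
  apply: (@fin_all_exists _ _ (fun i j => f i = lift t j)) => i.
  have ti : t != f i by apply: contraNneq tf => ->; exact: codom_f.
  by have [j ->] := unlift_some ti; exists j.
rewrite (expand_det_col _ t) (bigD1 t)//= Mf// eqxx mul1r big1 ?addr0; last first.
  by move=> i it; rewrite Mf// (negbTE it) mul0r.
rewrite /cofactor -signr_odd oddD addbb expr0 mul1r (IH f').
- by congr (\det _); apply/matrixP => i j; rewrite !mxE !f'E.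
- by move=> i j e; apply: finj; rewrite !f'E e.
- move=> j jf' i; rewrite !mxE Mf ?(inj_eq (@lift_inj _ _))//.
  apply: contra jf' => /codomP[i' ]; rewrite f'E => /lift_inj ->; exact: codom_f.
Qed.

(** The expansions of both determinants along the moved column have the same
    minors. *)
Lemma det_move_col k (X Y : 'M[R]_k.+1) (p q : 'I_k.+1) :
  (forall i, X i p = Y i q) -> (forall i j, X i (lift p j) = Y i (lift q j)) ->
  \det X = (-1) ^+ (p + q) * \det Y.
Proof.
move=> XY XY'; rewrite (expand_det_col X p) (expand_det_col Y q) mulr_sumr.
apply: eq_bigr => i _; rewrite XY /cofactor.
have -> : col' p X = col' q Y by apply/matrixP => r s; rewrite !mxE XY'.
rewrite [RHS]mulrCA [X in _ = _ * X]mulrA -exprD; congr (_ * (_ * _)).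
rewrite -signr_odd -[RHS]signr_odd !oddD.
by congr (_ ^+ nat_of_bool _); case: (odd p); case: (odd q); case: (odd i).
Qed.

Lemma det_replace_col_id n (a : 'I_n -> R) (j : 'I_n) :
  \det (\matrix_(i, k) (if k == j then a i else (i == k)%:R)) = a j.
Proof.
rewrite (expand_det_col _ j).
have adj1 : \adj (1%:M : 'M[R]_n) = 1%:M.
  by rewrite -[LHS]mul1mx mul_mx_adj det1.
set M := (X in cofactor X).
have E i : cofactor M i j = (i == j)%:R.
  transitivity (\adj (1%:M : 'M[R]_n) j i); last by rewrite adj1 mxE eq_sym.
  rewrite mxE; congr (_ * \det _); apply/matrixP => r s; rewrite !mxE.
  by rewrite eq_sym (negbTE (neq_lift j s)).
rewrite (bigD1 j)//= E mxE !eqxx mulr1 big1 ?addr0// => i ij.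
by rewrite E (negbTE ij) mulr0.
Qed.

End Determinants.

(** Cramer's rule. *)
Lemma det_replace_col (R : realType) n (M : 'M[R]_n) (c : 'cV[R]_n) (j : 'I_n) :
  \det (\matrix_(i, k) if k == j then (M *m c) i 0 else M i k) = c j 0 * \det M.
Proof.
rewrite -(det_replace_col_id (fun i => c i 0)) mulrC -det_mulmx; congr (\det _).
apply/matrixP => i k; rewrite !mxE; case: eqP => kj.
  by apply: eq_bigr => r _; rewrite mxE kj eqxx.
rewrite (bigD1 k)//= mxE eqxx big1 ?addr0.
  by case: eqP => // _; rewrite mulr1.
by move=> r rk; rewrite mxE (negbTE rk); case: eqP => // _; rewrite mulr0.
Qed.

(** * Minors of a face and the slopes of the objective *)

Section Minors.
Variables (R : realType) (n m : nat) (A : 'M[R]_(n, m.+1)).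
Implicit Types (J : {set 'I_n}) (I : {set 'I_m.+1}) (c : 'I_n -> 'I_m.+1).

(** Square matrix whose determinant is the minor with rows [J] and columns [c]:
    all the minors of the formula become determinants of the same size, to which
    Cramer's rule applies. *)
Definition padded J c : 'M[R]_n :=
  \matrix_(i, j) if j \in J then A i (c j) else (i == j)%:R.

Lemma det_padded J c :
  \det (padded J c) =
  \det (\matrix_(i < #|J|, j < #|J|) A (enum_val i) (c (enum_val j))).
Proof.
rewrite (@det_principal R #|J| n (@enum_val _ (mem J))); first last.
- move=> j jJ i; rewrite mxE ifF//; apply/negbTE; apply: contra jJ => jJ.
  by apply/codomP; exists (enum_rank_in jJ j); rewrite enum_rankK_in.
- exact: enum_val_inj.
by congr (\det _); apply/matrixP => i j; rewrite !mxE enum_valP.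
Qed.

(** The column of [I] that has the same rank in [I] as the row [j] has in [J].
    When [I] and [J] have the same size, the default values are only reached
    for [j \notin J]. *)
Definition column I J (j : 'I_n) : 'I_m.+1 := nth ord0 (enum I) (index j (enum J)).

Lemma index_enum_val J (x0 : 'I_n) (k : 'I_#|J|) : index (enum_val k) (enum J) = k.
Proof. by rewrite (enum_val_nth x0) index_uniq ?enum_uniq// -cardE. Qed.

Lemma minor_padded I J : minor A J I = \det (padded J (column I J)).
Proof.
rewrite det_padded; congr (\det _); apply/matrixP => i j; rewrite !mxE.
by rewrite /column (index_enum_val (enum_val j)).
Qed.

Section Face.
Variables (I : {set 'I_m.+1}) (J : {set 'I_n}).
Hypothesis IJ : #|I| = #|J|.
Hypothesis mI : ord_max \notin I.

Lemma column_in j : j \in J -> column I J j \in I.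
Proof.
by move=> jJ; rewrite -mem_enum mem_nth// -cardE IJ cardE index_mem mem_enum.
Qed.

Lemma map_column : map (column I J) (enum J) = enum I.
Proof.
apply: (@eq_from_nth _ ord0); first by rewrite size_map -!cardE.
rewrite size_map => k kJ; have [x0 _] : exists x : 'I_n, True.
  by case: (enum J) kJ => // x; exists x.
by rewrite (nth_map x0)// /column index_uniq ?enum_uniq.
Qed.

(** Columns of the minor, with rows [j |: J], that comes from replacing the
    column at [j] by the last one: this evicts [column I J j] if [j] is in [J],
    and adds a row and a column otherwise. *)
Definition exchange_set j :=
  (ord_max |: (if j \in J then I :\ column I J j else I))%SET.

Definition exchange_sign (j : 'I_n) :=
  (#|[set s in J | (s < j)%N]| + #|j |: J|.-1)%N.

(** In increasing order the column [ord_max] comes last, while the replaced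
    column sits at the rank of [j]. *)
Lemma minor_exchange j :
  minor A (j |: J) (exchange_set j) = (-1) ^+ exchange_sign j *
  \det (padded (j |: J) (fun k => if k == j then ord_max else column I J k)).
Proof.
have jJ' : j \in j |: J := setU11 j J.
rewrite det_padded /minor /exchange_sign.
have -> : #|[set s in J | (s < j)%N]| = index j (enum (j |: J)).
  rewrite index_enum_set//; apply: eq_card => s; rewrite !inE.
  by case: eqVneq => // ->; rewrite ltnn !andbF.
have : (index j (enum (j |: J)) < #|j |: J|)%N by rewrite cardE index_mem mem_enum.
set J' := j |: J; set p := index j (enum J') => pJ'.
set l := enum (if j \in J then I :\ column I J j else I).
have lE : enum (exchange_set j) = rcons l ord_max.
  rewrite /exchange_set enum_ord_max//; case: ifP => // _.
  by rewrite inE negb_and mI orbT.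
have sl : size l = #|J'|.-1.
  rewrite /l -cardE /J' cardsU1; case: ifPn => jJ; last by rewrite IJ.
  by have := cardsD1 (column I J j) I; rewrite column_in// IJ => ->.
have lnth k : (k < size l)%N ->
    nth ord0 l k = column I J (nth j (enum J') (bump p k)).
  move=> kl; rewrite /l /p /J'; case: ifPn => jJ.
    have -> : (j |: J)%SET = J.
      by apply/setP => x; rewrite !inE; case: eqVneq => // ->.
    have bk : (bump (index j (enum J)) k < size (enum J))%N.
      move: kl; rewrite /l jJ -!cardE.
      have := cardsD1 (column I J j) I; rewrite column_in// IJ => -> kl.
      by rewrite add1n ltnS (leq_trans _ kl)// /bump -add1n leq_add2r leq_b1.
    rewrite nth_enum_setD1 ?column_in// /column [in RHS]index_uniq ?enum_uniq//.
    have hI : (index j (enum J) < size (enum I))%N.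
      by rewrite -cardE IJ cardE index_mem mem_enum.
    by rewrite index_uniq ?enum_uniq.
  have kJ : (k < size (enum J))%N by move: kl; rewrite /l (negbTE jJ) -!cardE IJ.
  rewrite -nth_enum_setD1 ?setU11// setU1K// /column index_uniq ?enum_uniq//.
have nthE (k : 'I_#|J'|) : enum_val k = nth j (enum J') k := enum_val_nth j k.
under eq_mx => i k do rewrite lE nthE.
under [X in _ = _ * \det X]eq_mx => i k do rewrite !nthE.
have nth_p k : (k < size (enum J'))%N -> (nth j (enum J') k == j) = (k == p).
  by move=> kJ; rewrite -{2}(nth_index j (_ : j \in enum J')) ?mem_enum// nth_uniq
    ?enum_uniq// index_mem mem_enum.
move: pJ' sl lnth nth_p; rewrite -cardE; clear nthE.
case: #|J'| => [//|K] pK /= sl lnth nth_p.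
rewrite [(p + K)%N]addnC.
apply: (@det_move_col R K _ _ ord_max (Ordinal pK)).
- by move=> i; rewrite !mxE /= nth_rcons sl ltnn eqxx nth_p// eqxx.
move=> i k; have kK : (k < K)%N := ltn_ord k.
have pk : (bump p k < K.+1)%N by exact: (ltn_ord (lift (Ordinal pK) k)).
rewrite !mxE /= nth_p// [bump p k == p]eq_sym (negbTE (neq_bump p k)).
by rewrite {1}/bump leqNgt kK add0n nth_rcons sl kK lnth// sl.
Qed.

Lemma minor_exchange_slope (gam : 'cV[R]_n) j :
  col ord_max A = padded J (column I J) *m gam ->
  minor A (j |: J) (exchange_set j) =
  (-1) ^+ exchange_sign j * (gam j 0 * minor A J I).
Proof.
move=> Agam; rewrite minor_exchange minor_padded -det_replace_col -Agam.
congr (_ * \det _); apply/matrixP => i k; rewrite !mxE !inE.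
by case: eqVneq.
Qed.

Lemma sum_ltn k s : (\sum_(j < k) (s < j) = k - s.+1)%N.
Proof. by elim: k => [|k IH]; rewrite ?big_ord0// big_ord_recr /= IH; lia. Qed.

(** The pairs [s < j] with [s] in [J] number [\sum_(s in J) (n - s.+1)], which
    the sum of the [s.+1] completes to [n * #|J|]; the other terms make
    [n * #|J|] once more. *)
Lemma sum_exchange_sign :
  (\sum_j exchange_sign j + #|J| + \sum_(s in J) s.+1 = (n * #|J|).*2)%N.
Proof.
rewrite /exchange_sign big_split /=.
have -> : (\sum_(j < n) #|[set s in J | (s < j)%N]| = \sum_(s in J) (n - s.+1))%N.
  transitivity (\sum_(j < n) \sum_(s in J) (s < j))%N.
    apply: eq_bigr => j _; rewrite -sum1_card [RHS]big_mkcond [LHS]big_mkcond /=.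
    by apply: eq_bigr => s _; rewrite inE; case: (s \in J); case: ltnP.
  by rewrite exchange_big /=; apply: eq_bigr => s _; exact: sum_ltn.
have -> : (\sum_(j < n) #|j |: J|.-1 =
    \sum_(j in J) #|J|.-1 + \sum_(j in ~: J) #|J|)%N.
  rewrite (bigID (mem J)) /=; congr (_ + _)%N.
    by apply: eq_bigr => j jJ; rewrite cardsU1 jJ.
  by apply: eq_big => [j|j jJ]; rewrite ?inE// cardsU1 jJ.
rewrite !sum_nat_const.
have -> : (\sum_(s in J) (n - s.+1) = n * #|J| - \sum_(s in J) s.+1)%N.
  rewrite mulnC -sum_nat_const sumnB// => s _; exact: ltn_ord.
have : (\sum_(s in J) s.+1 <= n * #|J|)%N.
  by rewrite mulnC -sum_nat_const leq_sum// => s _; exact: ltn_ord.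
have := cardsC J; rewrite card_ord.
move: (\sum_(s in J) s.+1)%N #|J| #|~: J| => S [|k] c <- leS; nia.
Qed.

Lemma prod_minor_exchange :
  \prod_j minor A (j |: J) (exchange_set j) =
  (\prod_(t in I) minor A J (ord_max |: (I :\ t))%SET) *
  \prod_(t in ~: J) minor A (t |: J)%SET (ord_max |: I)%SET.
Proof.
rewrite (bigID (mem J)) /=; congr (_ * _); last first.
  by apply: eq_big => [j|j jJ]; rewrite ?inE// /exchange_set (negbTE jJ).
rewrite -[RHS]big_enum -map_column big_map big_enum /=.
apply: eq_bigr => j jJ; rewrite /exchange_set jJ; congr minor.
by apply/setP => x; rewrite !inE; case: eqVneq => // ->.
Qed.

(** [gam] holds the slopes along the edges, up to the orientation of the walls.
    In the application [Z] is the set of the zeros of a vertex, and the signs on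
    the left account for minus the slopes along inward edges: the
    walls of the ones are the only ones whose inward normal is opposite to the
    corresponding column of [padded]. *)
Lemma prod_signed_slopes (gam : 'cV[R]_n) (Z : {set 'I_n}) :
  col ord_max A = padded J (column I J) *m gam -> Z \subset ~: J ->
  \prod_j ((if (j \in J) || (j \in Z) then -1 else 1) * gam j 0) *
    minor A J I ^+ n =
  (-1) ^+ (#|Z| + \sum_(s in J) s.+1) *
  ((\prod_(t in I) minor A J (ord_max |: (I :\ t))%SET) *
  \prod_(t in ~: J) minor A (t |: J)%SET (ord_max |: I)%SET).
Proof.
move=> Agam ZJ; rewrite -prod_minor_exchange.
rewrite (eq_bigr _ (fun j _ => minor_exchange_slope j Agam)).
rewrite !big_split /= prodr_const card_ord !mulrA; congr (_ * _).
congr (_ * _); rewrite prodrXr -exprD.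
have -> : \prod_j (if (j \in J) || (j \in Z) then -1 else 1) =
    (-1) ^+ (#|J| + #|Z|) :> R.
  rewrite -big_mkcond /= prodr_const; congr (_ ^+ _).
  have -> : #|fun j => (j \in J) || (j \in Z)| = #|J :|: Z|.
    by apply: eq_card => j; rewrite !inE.
  rewrite cardsU disjoint_setI0 ?cards0 ?subn0//.
  by rewrite disjoint_sym disjoints_subset.
rewrite -signr_odd -[RHS]signr_odd; congr (_ ^+ nat_of_bool _).
have := congr1 odd sum_exchange_sign; rewrite odd_double !oddD.
case: (odd #|J|); case: (odd #|Z|); case: (odd (\sum_j _));
by case: (odd (\sum_(_ in _) _)).
Qed.

End Face.
End Minors.

From mathcomp Require Import all_classical all_reals all_analysis.
From mathcomp Require Import measurable_realfun.

Import numFieldNormedType.Exports.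
Local Open Scope classical_set_scope.
Local Open Scope ring_scope.

(** * Affine changes of variables *)

Section ChangeOfVariables.
Context {R : realType}.
Local Notation mu := (@lebesgue_measure R).

Lemma measurable_affine1 (a b : R) :
  measurable_fun [set: measurableTypeR R]
    (fun x => a * x + b : measurableTypeR R).
Proof. by apply: measurable_funD => //; apply: measurable_funM. Qed.

Lemma lebesgue_affine1 (a b : R) (A : set (measurableTypeR R)) :
  a != 0 -> measurable A ->
  mu [set x | A (a * x + b)] = (`|a|^-1%:E * mu A)%E.
Proof.
move=> a0 mA.
have a1 : 0 < `|a| by rewrite normr_gt0.
pose h (x : measurableTypeR R) : measurableTypeR R := a * x + b.
suff -> : mu A = mscale (NngNum (ltW a1)) (pushforward mu h) A.
- exact: measurable_affine1.
- by move=> mab; rewrite /mscale /pushforward /= muleA -EFinM mulVf ?mul1e ?gt_eqF.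
move=> mab; apply: lebesgue_measure_unique => //= _ [[c d] /= _ <-].
rewrite /mscale /=.
have [cd|dc] := ltP c d; last first.
  rewrite set_itv_ge; last by rewrite bnd_simp -leNgt.
  by rewrite /pushforward preimage_set0 !measure0 mule0.
rewrite /pushforward lebesgue_measure_itv /= lte_fin cd.
have [a_gt0|a_le0] := ltP 0 a.
  have -> : h @^-1` `]c, d] = `](c - b) / a, (d - b) / a]%classic.
    apply/seteqP; split => x /=; rewrite /h !in_itv /=;
    by rewrite ltr_pdivrMr// ler_pdivlMr// mulrC; lra.
  rewrite lebesgue_measure_itv /= lte_fin ltr_pM2r ?invr_gt0// ltrD2r cd.
  rewrite -!EFinB -EFinM (gtr0_norm a_gt0); congr EFin; field; rewrite gt_eqF//.
have a_lt0 : a < 0 by rewrite lt_neqAle a0.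
have -> : h @^-1` `]c, d] = `[(d - b) / a, (c - b) / a[%classic.
  apply/seteqP; split => x /=; rewrite /h !in_itv /=;
  by rewrite ltr_ndivlMr// ler_ndivrMr// mulrC; lra.
rewrite lebesgue_measure_itv /= lte_fin ltr_nM2r ?invr_lt0// ltrD2r cd.
rewrite -!EFinB -EFinM (ltr0_norm a_lt0); congr EFin; field; rewrite lt_eqF//.
Qed.

(** Measures on a product are determined by their values on rectangles. *)
Lemma product_measure_preimage d (T : measurableType d)
    (nu : {sigma_finite_measure set T -> \bar R})
    (phi : measurableTypeR R * T -> measurableTypeR R * T) (c : R) :
  0 < c -> measurable_fun [set: measurableTypeR R * T] phi ->
  (forall A B, measurable A -> measurable B ->
    (mu \x nu)%E (phi @^-1` (A `*` B)) = (c%:E * (mu A * nu B))%E) ->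
  forall X, measurable X -> (mu \x nu)%E (phi @^-1` X) = (c%:E * (mu \x nu)%E X)%E.
Proof.
move=> c0 mphi h X mX.
have c1 : 0 <= c^-1 by rewrite invr_ge0 ltW.
suff -> : (mu \x nu)%E X = mscale (NngNum c1) (pushforward (mu \x nu)%E phi) X.
- by rewrite /mscale /pushforward /= muleA -EFinM divff ?mul1e ?gt_eqF.
move=> mf; apply: product_measure_unique => // A B mA mB.
rewrite /mscale /pushforward [X in (_ * X = _)%E]h//=.
by rewrite muleA -EFinM mulVf ?mul1e ?gt_eqF.
Qed.

Lemma product_measure1_ysection d (T : measurableType d)
    (nu : {sigma_finite_measure set T -> \bar R})
    (X : set (measurableTypeR R * T)) : measurable X ->
  (mu \x nu)%E X = (\int[nu]_y mu (ysection X y))%E.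
Proof.
apply: (@product_measure_unique _ _ _ _ _ mu nu (mu \x^ nu)%E) => A B mA mB.
exact: product_measure2E.
Qed.

End ChangeOfVariables.

Section AffineImage.
Context {R : realType}.
Local Notation mu := (@lebesgue_measure R).

Definition row_of n (t : n.-tuple R) : 'rV[R]_n := \row_j tnth t j.

Definition affmap n (M : 'M[R]_n) (b : 'rV[R]_n) (t : n.-tuple R) : n.-tuple R :=
  [tuple (row_of t *m M + b) 0 j | j < n].

Lemma tnth_affmap n (M : 'M[R]_n) b t j :
  tnth (affmap M b t) j = \sum_i tnth t i * M i j + b 0 j.
Proof.
rewrite tnth_mktuple !mxE; congr (_ + _).
by apply: eq_bigr => i _; rewrite mxE.
Qed.

Lemma measurable_linear_form n (a : 'I_n -> R) (c : R) :
  measurable_fun [set: n.-tuple R]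
    (fun t : n.-tuple R => \sum_i tnth t i * a i + c).
Proof.
apply: measurable_funD => //; apply: measurable_sum => i.
by apply: measurable_funM => //; exact: measurable_tnth.
Qed.

Lemma measurable_affmap n (M : 'M[R]_n) b :
  measurable_fun [set: n.-tuple R] (affmap M b).
Proof.
apply/measurable_fun_tnthP => j.
rewrite (_ : _ \o _ = (fun t => \sum_i tnth t i * M i j + b 0 j)).
  exact: measurable_linear_form.
by apply/funext => t /=; rewrite tnth_affmap.
Qed.

Lemma affmapM n (M1 M2 : 'M[R]_n) b t :
  affmap (M1 *m M2) b t = affmap M2 b (affmap M1 0 t).
Proof.
apply: eq_from_tnth => j; rewrite !tnth_mktuple.
rewrite mulmxA; congr ((_ *m _ + _) 0 j).
by apply/rowP => k; rewrite [RHS]mxE tnth_mktuple addr0.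
Qed.

Definition scales_vol n (M : 'M[R]_n) := forall b B, measurable B ->
  vol n (affmap M b @^-1` B) = ((`|\det M|^-1)%:E * vol n B)%E.

Lemma scales_volM n (M1 M2 : 'M[R]_n) :
  scales_vol M1 -> scales_vol M2 -> scales_vol (M1 *m M2).
Proof.
move=> h1 h2 b B mB.
have -> : affmap (M1 *m M2) b @^-1` B = affmap M1 0 @^-1` (affmap M2 b @^-1` B).
  by apply/seteqP; split => t /=; rewrite affmapM.
have mB2 : measurable (affmap M2 b @^-1` B).
  by rewrite -[X in measurable X]setTI; exact: measurable_affmap.
by rewrite h1// h2// muleA -EFinM det_mulmx normrM invfM.
Qed.

Definition lower_right n (M : 'M[R]_n.+1) : 'M[R]_n := row' 0 (col' 0 M).
Definition unscons n (t : n.+1.-tuple R) : R * n.-tuple R :=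
  (thead t, [tuple of behead t]).

Lemma tconsK n (p : R * n.-tuple R) : unscons (tcons p) = p.
Proof.
case: p => x t; rewrite /unscons /tcons /=; congr pair.
by apply: val_inj.
Qed.

Lemma unsconsK n (t : n.+1.-tuple R) : tcons (unscons t) = t.
Proof. by rewrite /unscons /tcons /= [RHS]tuple_eta. Qed.

Lemma measurable_unscons n : measurable_fun [set: n.+1.-tuple R] (@unscons n).
Proof.
apply/measurable_fun_pairP; split; first exact: measurable_tnth.
exact: measurable_behead.
Qed.

Lemma scales_vol_step n (M : 'M[R]_n.+1) :
  \det M != 0 ->
  (forall b A B, measurable A -> measurable B ->
    (mu \x vol n)%E [set p | (A `*` B) (unscons (affmap M b (tcons p)))] =
    ((`|\det M|^-1)%:E * (mu A * vol n B))%E) -> scales_vol M.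
Proof.
move=> dM h b B mB /=; rewrite /lebesgue_step /pushforward.
have mphi : measurable_fun [set: measurableTypeR R * n.-tuple R]
    (fun p : measurableTypeR R * n.-tuple R =>
       unscons (affmap M b (tcons p)) : measurableTypeR R * n.-tuple R).
  apply: (measurableT_comp (@measurable_unscons n)).
  apply: (measurableT_comp (measurable_affmap M b)); exact: measurable_tcons.
have mB' : measurable (@tcons R n @^-1` B).
  by rewrite -[X in measurable X]setTI; exact: measurable_tcons.
rewrite -(product_measure_preimage _ mphi)//.
- by congr (_ _); apply/seteqP; split => p /=; rewrite unsconsK.
- by rewrite invr_gt0 normr_gt0.
- by move=> A1 A2 mA1 mA2; exact: h.
Qed.

Lemma tnth_affmap_tcons0 n (M : 'M[R]_n.+1) b p :
  tnth (affmap M b (tcons p)) 0 =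
  p.1 * M 0 0 + \sum_i tnth p.2 i * M (lift 0 i) 0 + b 0 0.
Proof.
rewrite tnth_affmap big_ord_recl; congr (_ * _ + _ + _).
by apply: eq_bigr => i _; rewrite tnthS.
Qed.

Lemma tnth_affmap_tconsS n (M : 'M[R]_n.+1) b p j :
  tnth (affmap M b (tcons p)) (lift 0 j) =
  p.1 * M 0 (lift 0 j) + \sum_i tnth p.2 i * lower_right M i j + b 0 (lift 0 j).
Proof.
rewrite tnth_affmap big_ord_recl; congr (_ * _ + _ + _).
by apply: eq_bigr => i _; rewrite tnthS !mxE.
Qed.

Lemma unscons_eq n (t : n.+1.-tuple R) x (u : n.-tuple R) :
  tnth t 0 = x -> (forall j, tnth t (lift 0 j) = tnth u j) -> unscons t = (x, u).
Proof.
move=> t0 tS; rewrite -[RHS]tconsK; congr unscons; apply: eq_from_tnth => j.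
case: (unliftP 0 j) => [i|] ->; first by rewrite tS tnthS.
by rewrite t0.
Qed.

Lemma det_lower_right n (M : 'M[R]_n.+1) :
  (forall i, M (lift 0 i) 0 = 0) -> \det M = M 0 0 * \det (lower_right M).
Proof.
move=> M0; rewrite (expand_det_col _ 0) big_ord_recl big1 ?addr0; last first.
  by move=> i _; rewrite M0 mul0r.
by rewrite /cofactor addn0 expr0 mul1r.
Qed.

(** The first coordinate of the image only depends on the first coordinate of
    the point: integrate first over the others, where [lower_right M] acts with
    a translation that depends on the first coordinate. *)
Lemma scales_vol_upper n (M : 'M[R]_n.+1) :
  \det M != 0 -> (forall i, M (lift 0 i) 0 = 0) ->
  scales_vol (lower_right M) -> scales_vol M.
Proof.
move=> dM M0 hM'.
have detM := det_lower_right M0.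
apply: scales_vol_step => // b A B mA mB.
have M00 : M 0 0 != 0 by apply: contraNneq dM => M00; rewrite detM M00 mul0r.
pose b' x : 'rV[R]_n := \row_j (x * M 0 (lift 0 j) + b 0 (lift 0 j)).
pose A' := [set x | A (M 0 0 * x + b 0 0)].
have mA' : measurable (A' : set (measurableTypeR R)).
  by rewrite -[X in measurable X]setTI; exact: measurable_affine1.
have phiE p : unscons (affmap M b (tcons p)) =
    (M 0 0 * p.1 + b 0 0, affmap (lower_right M) (b' p.1) p.2).
  apply: unscons_eq => [|j].
    by rewrite tnth_affmap_tcons0 big1 ?addr0 1?mulrC// => i _; rewrite M0 mulr0.
  by rewrite tnth_affmap_tconsS tnth_affmap mxE; ring.
transitivity (\int[mu]_x vol n
  (xsection [set p | (A `*` B) (unscons (affmap M b (tcons p)))] x))%E => //.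
rewrite (eq_integral (fun x : measurableTypeR R =>
  (\1_A' x)%:E * ((`|\det (lower_right M)|^-1)%:E * vol n B))%E); last first.
  move=> x _ /=; rewrite -(hM' (b' x))//.
  have -> : xsection [set p | (A `*` B) (unscons (affmap M b (tcons p)))] x =
     if x \in A' then affmap (lower_right M) (b' x) @^-1` B else set0.
    have key t : (A `*` B) (unscons (affmap M b (tcons (x, t)))) <->
        A' x /\ (affmap (lower_right M) (b' x) @^-1` B) t by rewrite phiE.
    apply/seteqP; split => t.
      by move=> /xsectionP/key[Ax Bt]; rewrite ifT// inE.
    by case: ifPn => // xA Bt; apply/xsectionP/key; split => //; rewrite inE in xA.
  rewrite indicE; case: ifPn => xA; first by rewrite mul1e.
  by rewrite measure0 mul0e.
rewrite ge0_integralZr//; last 2 first.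
- exact/measurable_EFinP.
- by rewrite mule_ge0// lee_fin invr_ge0.
rewrite integral_indic// setIT.
have E := lebesgue_affine1 (b 0 0) M00 mA.
rewrite [X in (X * _)%E]E detM normrM invfM EFinM.
by rewrite -!muleA; congr (_ * _)%E; rewrite muleCA.
Qed.

(** The converse order of integration: the first coordinate undergoes a scaling
    and a translation that depends on the others. *)
Lemma scales_vol_lower n (M : 'M[R]_n.+1) :
  \det M != 0 -> (forall j, M 0 (lift 0 j) = 0) ->
  scales_vol (lower_right M) -> scales_vol M.
Proof.
move=> dM M0 hM'.
have detM : \det M = M 0 0 * \det (lower_right M).
  rewrite (expand_det_row _ 0) big_ord_recl big1 ?addr0; last first.
    by move=> i _; rewrite M0 mul0r.
  by rewrite /cofactor addn0 expr0 mul1r.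
apply: scales_vol_step => // b A B mA mB.
have M00 : M 0 0 != 0 by apply: contraNneq dM => M00; rewrite detM M00 mul0r.
pose b' : 'rV[R]_n := \row_j b 0 (lift 0 j).
pose c (t : n.-tuple R) := \sum_i tnth t i * M (lift 0 i) 0 + b 0 0.
pose B' := affmap (lower_right M) b' @^-1` B.
have mB' : measurable B'.
  by rewrite -[X in measurable X]setTI; exact: measurable_affmap.
have phiE p : unscons (affmap M b (tcons p)) =
    (M 0 0 * p.1 + c p.2, affmap (lower_right M) b' p.2).
  apply: unscons_eq => [|j].
    by rewrite tnth_affmap_tcons0 /c; ring.
  by rewrite tnth_affmap_tconsS tnth_affmap mxE M0; ring.
rewrite product_measure1_ysection; last first.
  rewrite -[X in measurable X]setTI.
  apply: (measurableT_comp (@measurable_unscons n)) => //; last exact: measurableX.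
  apply: (measurableT_comp (measurable_affmap M b)); exact: measurable_tcons.
rewrite (eq_integral
  (fun t => (\1_B' t)%:E * ((`|M 0 0|^-1)%:E * mu A))%E); last first.
  move=> t _ /=; rewrite -(lebesgue_affine1 (c t))//.
  have -> : ysection [set p | (A `*` B) (unscons (affmap M b (tcons p)))] t =
     if t \in B' then [set x | A (M 0 0 * x + c t)] else set0.
    have key x : (A `*` B) (unscons (affmap M b (tcons (x, t)))) <->
        A (M 0 0 * x + c t) /\ B' t by rewrite phiE.
    apply/seteqP; split => x.
      by move=> /ysectionP/key[Ax Bt]; rewrite ifT// inE.
    by case: ifPn => // tB Ax; apply/ysectionP/key; split => //; rewrite inE in tB.
  rewrite indicE; case: ifPn => tB; first by rewrite mul1e.
  by rewrite measure0 mul0e.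
rewrite ge0_integralZr//; last 2 first.
- exact/measurable_EFinP.
- by rewrite mule_ge0// lee_fin invr_ge0.
rewrite integral_indic// setIT.
have E := hM' b' B mB; rewrite [X in (X * _)%E]E detM normrM invfM EFinM.
by rewrite muleACA; congr (_ * _)%E; exact: muleC.
Qed.

(** Block elimination writes an invertible matrix as a product of a lower and an
    upper block triangular matrix with smaller invertible diagonal blocks, once
    the corner entry is nonzero; adding another row to the first one makes it
    so. *)
Lemma affmap_scales_vol n (M : 'M[R]_n) : \det M != 0 -> scales_vol M.
Proof.
elim: n => [|n IH] in M *.
  move=> _ b B mB; rewrite det_mx00 normr1 invr1 mul1e.
  congr (vol 0 _); apply/seteqP; split => t /=;
  by rewrite (tuple0 (affmap M b t)) (tuple0 t).
wlog M00 : M / M 0 0 != 0.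
  move=> W; have [M00|] := eqVneq (M 0 0) 0; last exact: W.
  move=> dM; have [i Mi0] : exists i, M (lift 0 i) 0 != 0.
    apply: contrapT => noi; move/eqP: dM; apply.
    rewrite (expand_det_col _ 0) big1// => j _.
    case: (unliftP 0 j) => [i|] ->; last by rewrite M00 mul0r.
    have [->|Mi0] := eqVneq (M (lift 0 i) 0) 0; first by rewrite mul0r.
    by exfalso; apply: noi; exists i.
  pose sh a : 'M[R]_n.+1 := 1%:M + a *: delta_mx 0 (lift 0 i).
  have sh0 a j : sh a (lift 0 j) 0 = 0 by rewrite !mxE /= mulr0 addr0.
  have shS a : lower_right (sh a) = 1%:M.
    apply/matrixP => j k; rewrite !mxE /= mulr0 addr0.
    by rewrite (inj_eq (@lift_inj _ 0)).
  have dsh a : \det (sh a) = 1.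
    by rewrite det_lower_right// shS det1 !mxE /= mulr0 addr0 mulr1.
  have shsh : sh (-1) *m sh 1 = 1%:M.
    rewrite /sh scaleN1r scale1r mulmxDl mulmxDr !mul1mx mulmxDr mulmx1.
    rewrite mulNmx mul_delta_mx_0// oppr0 addr0 -addrA subrr addr0 //.
  have -> : M = sh (-1) *m (sh 1 *m M) by rewrite mulmxA shsh mul1mx.
  apply: scales_volM.
    apply: scales_vol_upper => //; rewrite ?dsh ?oner_neq0// shS.
    by apply: IH; rewrite det1 oner_neq0.
  apply: W; last by rewrite det_mulmx dsh mul1r.
  rewrite /sh scale1r mulmxDl mul1mx mxE M00 add0r mxE (bigD1 (lift 0 i))//=.
  rewrite big1 ?addr0 ?mxE ?eqxx ?mul1r// => j ji.
  by rewrite mxE (negbTE ji) andbF mul0r.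
move=> dM.
pose U : 'M[R]_n.+1 := \matrix_(i, j)
  if unlift 0 i is Some i' then
    if unlift 0 j is Some j' then
      M (lift 0 i') (lift 0 j') - M (lift 0 i') 0 / M 0 0 * M 0 (lift 0 j')
    else 0
  else M 0 j.
pose L : 'M[R]_n.+1 := \matrix_(i, j)
  if unlift 0 i is Some i' then
    if unlift 0 j is Some j' then (i' == j')%:R else M (lift 0 i') 0 / M 0 0
  else (j == 0)%:R.
have ME : M = L *m U.
  apply/matrixP => i j; rewrite mxE big_ord_recl.
  case: (unliftP 0 i) => [i'|] ->; rewrite !mxE ?unlift_none ?liftK.
    under eq_bigr => k _ do rewrite !mxE !liftK.
    case: (unliftP 0 j) => [j'|] ->; rewrite ?unlift_none ?liftK.
      rewrite (bigD1 i')//= eqxx mul1r big1 ?addr0 => [|k ki].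
        by rewrite addrC subrK.
      by rewrite eq_sym (negbTE ki) mul0r.
    by rewrite big1 ?addr0 ?mulfVK// => k _; rewrite mulr0.
  rewrite eqxx mul1r big1 ?addr0// => k _.
  by rewrite !mxE unlift_none /= mul0r.
have L0 j : L 0 (lift 0 j) = 0 by rewrite mxE unlift_none.
have LS : lower_right L = 1%:M.
  by apply/matrixP => i j; rewrite !mxE !liftK.
have U0 i : U (lift 0 i) 0 = 0 by rewrite mxE liftK unlift_none.
have [dL dU] : \det L != 0 /\ \det U != 0.
  by move: dM; rewrite ME det_mulmx mulf_eq0 negb_or => /andP[].
rewrite ME; apply: scales_volM.
  by apply: scales_vol_lower => //; rewrite LS; apply: IH; rewrite det1 oner_neq0.
apply: scales_vol_upper => //; apply: IH.
by apply: contraNneq dU => dU'; rewrite det_lower_right// dU' mulr0.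
Qed.

End AffineImage.

(** * Simplices, hyperplanes and signed sums of indicators *)

Section Simplex.
Context {R : realType}.
Local Notation mu := (@lebesgue_measure R).

Lemma measurable_halfspace n (a : 'I_n -> R) (c : R) :
  measurable [set t : n.-tuple R | 0 <= \sum_i tnth t i * a i + c].
Proof.
rewrite -[X in measurable X]setTI.
have -> : [set t : n.-tuple R | 0 <= \sum_i tnth t i * a i + c] =
  (fun t : n.-tuple R => \sum_i tnth t i * a i + c) @^-1` `[0, +oo[.
  by apply/seteqP; split => t /=; rewrite in_itv/= andbT.
by apply: measurable_linear_form => //; exact: measurable_itv.
Qed.

Lemma measurable_hyperplane n (a : 'I_n -> R) (c : R) :
  measurable [set t : n.-tuple R | \sum_i tnth t i * a i + c = 0].
Proof.
rewrite -[X in measurable X]setTI.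
have -> : [set t : n.-tuple R | \sum_i tnth t i * a i + c = 0] =
  (fun t : n.-tuple R => \sum_i tnth t i * a i + c) @^-1` [set 0] by [].
by apply: measurable_linear_form.
Qed.

Definition simplex n (c : R) : set (n.-tuple R) :=
  [set t | (forall i, 0 <= tnth t i) /\ \sum_i tnth t i <= c].

Lemma measurable_simplex n c : measurable (@simplex n c).
Proof.
have -> : @simplex n c = (\bigcap_(i in [set: 'I_n])
    [set t : n.-tuple R | 0 <= \sum_j tnth t j * (j == i)%:R + 0]) `&`
    [set t : n.-tuple R | 0 <= \sum_i tnth t i * (-1) + c].
  have E i (t : n.-tuple R) : \sum_j tnth t j * (j == i)%:R + 0 = tnth t i.
    rewrite addr0 (bigD1 i)//= eqxx mulr1 big1 ?addr0// => j /negbTE ->.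
    by rewrite mulr0.
  apply/seteqP; split => t /=.
    move=> [h1 h2]; split; first by move=> i _ /=; rewrite E.
    by rewrite -mulr_suml; lra.
  move=> [h1]; rewrite -mulr_suml => h2; split; last by lra.
  by move=> i; have := h1 i I; rewrite /= E.
apply: measurableI; last exact: measurable_halfspace.
by apply: fin_bigcap_measurable => // i _; exact: measurable_halfspace.
Qed.

Lemma integral_power (n : nat) (c : R) : 0 <= c ->
  (\int[mu]_(x in `[0%R, c]) ((c - x)%R ^+ n / n`!%:R)%:E)%E =
  (c ^+ n.+1 / n.+1`!%:R)%:E.
Proof.
rewrite le_eqVlt => /predU1P[<-|c0].
  by rewrite set_itv1 integral_set1 expr0n mul0r.
pose F (x : R) : R := - ((c - x) ^+ n.+1 / n.+1`!%:R).
have dF (x : R) : is_derive x 1 F ((c - x) ^+ n / n`!%:R).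
  have -> : F = (- n.+1`!%:R^-1) *: ((cst c - id) ^+ n.+1).
    apply/funext => y; by rewrite /F !fctE [RHS]mulNr mulrC.
  apply: is_derive_eq.
  transitivity (- n.+1`!%:R^-1 * (n.+1%:R * (c - x) ^+ n * (0 - 1))) => //.
  have n0 : n`!%:R != 0 :> R by rewrite pnatr_eq0 -lt0n fact_gt0.
  have n1 : n.+1%:R != 0 :> R by rewrite pnatr_eq0.
  rewrite factS natrM; move: n`!%:R n.+1%:R n0 n1 => k l k0 l0.
  by field; rewrite k0 l0.
have cF : continuous F.
  move=> x; apply: differentiable_continuous; apply/derivable1_diffP.
  by case: (dF x).
rewrite (@continuous_FTC2 _ _ F)//.
- by rewrite /F subrr subr0 expr0n mul0r oppr0 sub0e -EFinN opprK.
- apply: continuous_subspaceT => x.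
  apply: differentiable_continuous; apply/derivable1_diffP.
  have -> : (fun x => (c - x) ^+ n / n`!%:R) = n`!%:R^-1 *: ((cst c - id) ^+ n).
    by apply/funext => y; rewrite !fctE [RHS]mulrC.
  exact: ex_derive.
- split => [x _||].
  + by case: (dF x).
  + by apply: cvg_at_right_filter; exact: cF.
  + by apply: cvg_at_left_filter; exact: cF.
- by move=> x _; rewrite derive1E; case: (dF x).
Qed.

(** The slice at height [x] is the simplex of size [c - x] one dimension
    below. *)
Lemma vol_simplex n (c : R) : 0 <= c ->
  vol n (@simplex n c) = (c ^+ n / n`!%:R)%:E.
Proof.
elim: n c => [|n IH] c c0.
  rewrite /= diracE mem_set ?expr0 ?fact0 ?divr1//.
  by split => [[]//|]; rewrite big_ord0.
rewrite /= /lebesgue_step /pushforward.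
transitivity (\int[mu]_x vol n
  (xsection (@tcons R n @^-1` @simplex n.+1 c) x))%E => //.
rewrite -integral_power// [RHS]integral_mkcond.
apply: eq_integral => x _; rewrite patchE.
have -> : xsection (@tcons R n @^-1` @simplex n.+1 c) x =
    if x \in `[0, c]%classic then @simplex n (c - x) else set0.
  have key t : (@tcons R n @^-1` @simplex n.+1 c) (x, t) <->
      0 <= x /\ @simplex n (c - x) t.
    have sumE : \sum_i tnth (tcons (x, t)) i = x + \sum_i tnth t i.
      rewrite big_ord_recl; congr (_ + _).
      by apply: eq_bigr => i _; exact: (tnthS x t i).
    rewrite /preimage /simplex /= sumE.
    split => [[h1 h2]|[x0 [h1 h2]]].
      split; first exact: (h1 ord0).
      by split => [i|]; [rewrite -(tnthS x t i); exact: h1|lra].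
    split => [i|]; last by lra.
    by case: (unliftP ord0 i) => [j|] -> //; rewrite (tnthS x t j).
  have pos t : @simplex n (c - x) t -> x <= c.
    move=> [h1 h2]; have : 0 <= \sum_i tnth t i by apply: sumr_ge0.
    by lra.
  apply/seteqP; split => t.
    move=> /xsectionP/key[x0 ht]; rewrite ifT// inE /= in_itv /= x0 (pos t)//.
  case: ifPn => //; rewrite inE /= in_itv /= => /andP[x0 xc] ht.
  by apply/xsectionP/key.
case: ifPn => [|_]; last by rewrite measure0.
rewrite inE /= in_itv /= => /andP[x0 xc].
by rewrite IH// subr_ge0.
Qed.

(** The affine map that replaces the [j]-th coordinate by the equation turns the
    hyperplane into a coordinate hyperplane, a product with a null factor. *)
Lemma vol_hyperplane n (a : 'I_n -> R) (c : R) (j : 'I_n) : a j != 0 ->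
  vol n [set t : n.-tuple R | \sum_i tnth t i * a i + c = 0] = 0%E.
Proof.
move=> aj.
pose M : 'M[R]_n := \matrix_(i, k) (if k == j then a i else (i == k)%:R).
pose b : 'rV[R]_n := \row_k (if k == j then c else 0).
pose A (k : 'I_n) : set R := if k == j then [set 0] else setT.
have mA k : measurable (A k) by rewrite /A; case: ifP.
have dM : \det M != 0 by rewrite det_replace_col_id.
pose B := [set t : n.-tuple R | forall i, A i (tnth t i)].
have -> : [set t : n.-tuple R | \sum_i tnth t i * a i + c = 0] = affmap M b @^-1` B.
  have E t : tnth (affmap M b t) j = \sum_i tnth t i * a i + c.
    rewrite tnth_affmap mxE eqxx; congr (_ + _); apply: eq_bigr => i _.
    by rewrite mxE eqxx.
  apply/seteqP; split => t /= h.
    by move=> k; rewrite /A; case: eqP => [->|//] /=; rewrite E.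
  by have := h j; rewrite /A eqxx /= E.
have mB : measurable B.
  have -> : B = \bigcap_(i in [set: 'I_n]) ((@tnth n R)^~ i @^-1` A i).
    by apply/seteqP; split => x /= Ax i => [_|]; exact: Ax.
  apply: fin_bigcap_measurable => // i _.
  by rewrite -[X in measurable X]setTI; exact: measurable_tnth.
rewrite affmap_scales_vol// vol_prod// (bigD1 j)//= /A eqxx.
by rewrite lebesgue_measure_set1 mul0e mule0.
Qed.

End Simplex.

Lemma measure_signed_indic d (T : measurableType d) (R : realType)
    (mu : {measure set T -> \bar R}) (I : finType) (P : pred I) (c : I -> R)
    (K : I -> set T) (X : set T) :
  measurable X -> (forall i, P i -> measurable (K i)) ->
  (forall i, P i -> mu (K i) < +oo)%E ->
  (forall x, \1_X x = \sum_(i | P i) c i * \1_(K i) x) ->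
  mu X = (\sum_(i | P i) (c i)%:E * mu (K i))%E.
Proof.
move=> mX mK finK XE.
pose K' i := if P i then K i else set0.
have mK' i : measurable (K' i) by rewrite /K'; case: ifP => // /mK.
have finK' i : (mu (K' i) < +oo)%E.
  by rewrite /K'; case: ifP => [/finK//|_]; rewrite measure0.
have intK i : mu.-integrable setT (fun x => (\1_(K' i) x)%:E).
  apply/integrableP; split; first exact/measurable_EFinP.
  under eq_integral => x _ do rewrite gee0_abs ?lee_fin//.
  by rewrite integral_indic// setIT.
have := integral_indic mu measurableT mX; rewrite setIT => <-.
transitivity (\int[mu]_x (\sum_(i | P i) (c i)%:E * (\1_(K' i) x)%:E))%E.
  apply: eq_integral => x _; rewrite XE -sumEFin; apply: eq_bigr => i Pi.
  by rewrite /K' Pi EFinM.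
rewrite integral_sum//; last by move=> i; exact: integrableZl.
apply: eq_bigr => i Pi; rewrite (integralZl measurableT (intK i)).
by rewrite integral_indic// setIT /K' Pi.
Qed.

(** * The clipped cube as a system of constraints *)

Section Clipping.
Variables (R : realType) (n m : nat) (A : 'M[R]_(n, m.+1)) (r : 'rV[R]_m.+1).
Local Notation N := (('I_n * bool) + 'I_m.+1)%type.

(** The constraint [inl (j, b)] is the facet of the cube on which the [j]-th
    coordinate is [b], and [inr i] is the [i]-th half-space.  The objective, the
    last half-space, is one of the constraints; it is never tight where it is
    positive. *)
Definition gradient (t : N) : 'cV[R]_n :=
  match t with
  | inl (j, b) => (if b then -1 else 1) *: delta_mx j 0
  | inr i => col i A
  end.

Definition offset (t : N) : R :=
  match t with inl (_, b) => if b then 1 else 0 | inr i => r 0 i end.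

Definition lin (t : N) (d : 'rV[R]_n) : R := (d *m gradient t) 0 0.
Local Notation goal := (inr ord_max : N).

Lemma lin_linear s a x d : lin s (a *: x + d) = a * lin s x + lin s d.
Proof. by rewrite /lin mulmxDl -scalemxAl !mxE. Qed.

Lemma linE s d : lin s d = \sum_j d 0 j * gradient s j 0.
Proof. by rewrite /lin mxE. Qed.

Lemma lin_cube j b d : lin (inl (j, b)) d = (if b then -1 else 1) * d 0 j.
Proof.
rewrite /lin /= -scalemxAr mxE; congr (_ * _).
rewrite mxE (bigD1 j)//= mxE !eqxx mulr1 big1 ?addr0// => i ij.
by rewrite mxE (negbTE ij) mulr0.
Qed.

Local Notation slack := (slack lin offset).
Local Notation tight := (tight lin offset).
Local Notation feasible := (feasible lin offset).
Local Notation is_vertex := (is_vertex lin offset (lin goal) (offset goal)).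
Implicit Types (x d : 'rV[R]_n) (v t : n.-tuple R) (I : {set 'I_m.+1}).
Implicit Types (s : N) (T : {set N}).

Lemma slack_affine i v : slack (inr i) (row_of v) = affine A r i v.
Proof.
rewrite /slack linE; congr (_ + _); apply: eq_bigr => j _.
by rewrite !mxE mulrC.
Qed.

Lemma slack_cube0 j v : slack (inl (j, false)) (row_of v) = tnth v j.
Proof. by rewrite /slack lin_cube mxE mul1r addr0. Qed.

Lemma slack_cube1 j v : slack (inl (j, true)) (row_of v) = 1 - tnth v j.
Proof. by rewrite /slack lin_cube mxE mulN1r addrC. Qed.

Lemma feasibleP v : feasible (row_of v) <-> (cube `&` polyhedron A r) v.
Proof.
split=> [/forallP fv|[cv pv]].
  split=> [j|i _]; last by have := fv (inr i); rewrite slack_affine.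
  have := fv (inl (j, false)); have := fv (inl (j, true)).
  by rewrite slack_cube0 slack_cube1 subr_ge0 => -> ->.
apply/forallP => -[[j b]|i]; last by rewrite slack_affine; exact: pv.
have /andP[v0 v1] := cv j.
by case: b; rewrite ?slack_cube1 ?slack_cube0// subr_ge0.
Qed.

Lemma cube_bounded d : d != 0 -> exists s, lin s d < 0.
Proof.
move=> d0; have [j dj] : exists j, d 0 j != 0.
  apply: contrapT => nd; move/eqP: d0; apply; apply/rowP => j; rewrite mxE.
  by apply/eqP; apply: contrapT => /negP dj; apply: nd; exists j.
have [dl|dl|/eqP] := ltgtP (d 0 j) 0; last by rewrite (negbTE dj).
  by exists (inl (j, false)); rewrite lin_cube mul1r.
by exists (inl (j, true)); rewrite lin_cube mulN1r oppr_lt0.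
Qed.

Definition tight_affine v : {set 'I_m.+1} := [set i | affine A r i v == 0]%SET.

Lemma in_tight_affine v i : (i \in tight_affine v) = (inr i \in tight (row_of v)).
Proof. by rewrite !inE slack_affine. Qed.

Lemma not_stars v j : (j \notin stars v) = (tnth v j == 0) || (tnth v j == 1).
Proof. by rewrite inE negb_and !negbK. Qed.

Lemma bullets_stars v : bullets v = (~: stars v)%SET.
Proof. by apply/setP => j; rewrite finset.in_setC not_stars !inE. Qed.

Section Point.
Variable v : n.-tuple R.
Let I := tight_affine v.
Let J := stars v.
Hypothesis IJ : #|I| = #|J|.

(** The columns of the frame are the normals of the walls through [v], the walls
    of the cube having the positive unit vectors as normals.  The wall [facet j]
    is the one of column [j], and [facet_sign j] is minus the factor between its
    inward normal and that column. *)
Definition frame : 'M[R]_n := padded A J (column I J).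
Definition facet (j : 'I_n) : N :=
  if j \in J then inr (column I J j) else inl (j, tnth v j == 1).
Definition facet_sign (j : 'I_n) : R :=
  if (j \in J) || (j \in zeros v) then -1 else 1.

Lemma facet_signK j : facet_sign j * facet_sign j = 1.
Proof. by rewrite /facet_sign; case: ifP; rewrite ?mulrNN mulr1. Qed.

Lemma facet_tight j : facet j \in tight (row_of v).
Proof.
rewrite /facet; case: ifPn => jJ; first by rewrite -in_tight_affine column_in.
rewrite inE; move: jJ; rewrite not_stars; case: (eqVneq (tnth v j) 1) => [v1 _|_].
  by rewrite slack_cube1 v1 subrr.
by rewrite orbF slack_cube0.
Qed.

Lemma tight_facet s : s \in tight (row_of v) -> exists j, s = facet j.
Proof.
case: s => [[j b]|i].
  move=> tj; exists j.
  have vj : tnth v j = b%:R.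
    by case: b tj; rewrite inE ?slack_cube1 ?slack_cube0 ?subr_eq0 => /eqP.
  rewrite /facet ifF; last first.
    by apply/negbTE; rewrite not_stars vj; case: b {tj vj}; rewrite eqxx ?orbT.
  by rewrite vj; case: b {tj vj}; rewrite ?eqxx// eq_sym oner_eq0.
rewrite -in_tight_affine -mem_enum -(map_column IJ) => /mapP[j].
by rewrite mem_enum => jJ ->; exists j; rewrite /facet jJ.
Qed.

Lemma column_inj : {in J &, injective (column I J)}.
Proof.
move=> j k jJ kJ /eqP.
rewrite /column nth_uniq ?enum_uniq -?cardE ?IJ ?cardE ?index_mem ?mem_enum//.
move=> /eqP e; rewrite -[j](@nth_index _ j j (enum J)) ?mem_enum// e.
by rewrite nth_index ?mem_enum.
Qed.

Lemma facet_inj : injective facet.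
Proof.
move=> j k; rewrite /facet; case: ifPn => jJ; case: ifPn => kJ //.
  by case=> /column_inj; exact.
by case.
Qed.

Lemma tightE : tight (row_of v) = [set facet j | j in 'I_n]%SET.
Proof.
apply/setP => t; apply/idP/imsetP => [/tight_facet[j ->]|[j _ ->]].
  by exists j.
exact: facet_tight.
Qed.

Lemma lin_facet j d : lin (facet j) d = - facet_sign j * (d *m frame) 0 j.
Proof.
rewrite /facet /facet_sign /frame; case: ifPn => jJ /=.
  rewrite opprK mul1r linE mxE; apply: eq_bigr => i _.
  by rewrite !mxE jJ.
rewrite lin_cube.
have -> : (d *m padded A J (column I J)) 0 j = d 0 j.
  rewrite mxE (bigD1 j)//= mxE (negbTE jJ) eqxx mulr1 big1 ?addr0// => i ij.
  by rewrite mxE (negbTE jJ) (negbTE ij) mulr0.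
move: jJ; rewrite not_stars inE; case: (eqVneq (tnth v j) 1) => [->|_].
  by rewrite oner_eq0.
by rewrite orbF => ->; rewrite opprK.
Qed.

Lemma det_frame : \det frame = minor A J I.
Proof. by rewrite minor_padded. Qed.

Lemma pins_frame : pins lin (tight (row_of v)) <-> \det frame != 0.
Proof.
have alongE d : along lin (tight (row_of v)) d <-> d *m frame = 0.
  split=> [/forall_inP h|h].
    apply/rowP => j; rewrite [RHS]mxE; have /eqP := h _ (facet_tight j).
    rewrite lin_facet => /(congr1 (fun y => - facet_sign j * y)).
    by rewrite mulrA mulrNN facet_signK mul1r mulr0.
  apply/forall_inP => t /tight_facet[j ->].
  by rewrite lin_facet h mxE mulr0.
split=> [pinned|dM d /alongE h].
  by apply/negP => /det0P[d d0 /alongE/pinned]; exact/eqP.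
apply/eqP; apply: contraNT dM => d0; apply/det0P; by exists d.
Qed.

End Point.

(** Fewer than [n] linear equations have a nonzero common solution. *)
Lemma pins_card (T : {set N}) : pins lin T -> (n <= #|T|)%N.
Proof.
move=> pinned; rewrite leqNgt; apply/negP => Tn.
pose W : 'M[R]_(n, #|T|) := \matrix_(i, k) gradient (enum_val k) i 0.
have : kermx W != 0.
  rewrite kermx_eq0 /row_free; apply/negP => /eqP rW.
  by have := rank_leq_col W; rewrite rW leqNgt Tn.
move=> /rowV0Pn[d /sub_kermxP dW]; apply/negP; rewrite negbK; apply/eqP/pinned.
apply/forall_inP => t tT.
have := congr1 (fun M : 'rV__ => M 0 (enum_rank_in tT t)) dW.
rewrite !mxE => <-; rewrite linE; apply/eqP; apply: eq_bigr => i _.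
by rewrite mxE enum_rankK_in.
Qed.

(** * Vertices of the clipped cube *)

Hypothesis good : good_clipping A r.

Lemma flat_tight_affine v I :
  (cube `&` polyhedron A r) v -> affine A r ord_max v != 0 ->
  I \subset tight_affine v -> flat A r I v.
Proof.
move=> [cv pv] av Iv; split; last exact/eqP.
by split => // i /= iI; apply/eqP; have := fintype.subsetP Iv i iI; rewrite inE.
Qed.

(** With more tight hyperplanes than stars, the point would be in the face
    excluded by the first condition for a set of [#|stars v|.+1] of them. *)
Lemma card_tight_affine v :
  (cube `&` polyhedron A r) v -> affine A r ord_max v != 0 ->
  (#|tight_affine v| <= #|stars v|)%N.
Proof.
move=> cpv av; rewrite leqNgt; apply/negP => lt.
set K := tight_affine v in lt *.
pose I := [set i in take #|stars v|.+1 (enum K)]%SET.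
have IK : I \subset K.
  by apply/fintype.subsetP => i; rewrite inE => /mem_take; rewrite mem_enum.
have cI : #|I| = #|stars v|.+1.
  rewrite cardsE (card_uniqP _) ?take_uniq ?enum_uniq// size_takel//.
  by rewrite -cardE.
have mI : ord_max \notin I.
  by apply: contra av => /(fintype.subsetP IK); rewrite inE.
have [h _] := good; have /seteqP[h0 _] := h I mI; apply: (h0 v); split.
  by split; [case: cpv|rewrite cI -addn1 PoszD addrK].
exact: flat_tight_affine.
Qed.

Lemma card_stars v :
  pins lin (tight (row_of v)) -> (#|stars v| <= #|tight_affine v|)%N.
Proof.
move=> /pins_card; set T := tight _ => nT.
have TE : T \subset ((fun j => inl (j, tnth v j == 1)) @: (~: stars v) :|:
    inr @: tight_affine v)%SET.
  apply/fintype.subsetP => -[[j b]|i] tT; rewrite inE; apply/orP; [left|right].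
    have vj : tnth v j = b%:R.
      by case: b tT; rewrite inE ?slack_cube1 ?slack_cube0 ?subr_eq0 => /eqP.
    apply/imsetP; exists j.
      by rewrite finset.in_setC not_stars vj; case: b {tT vj}; rewrite eqxx ?orbT.
    by rewrite vj; case: b {tT vj}; rewrite ?eqxx// eq_sym oner_eq0.
  by apply: imset_f; rewrite in_tight_affine.
have h1 := leq_trans (leq_trans nT (subset_leq_card TE)) (leq_card_setU _ _).
have h2 := leq_trans h1 (leq_add (leq_imset_card _ _) (leq_imset_card _ _)).
by rewrite -(leq_add2r #|~: stars v|%SET) cardsC card_ord addnC.
Qed.

Lemma objectiveE v :
  objective (lin goal) (offset goal) (row_of v) = affine A r ord_max v.
Proof. by rewrite -slack_affine. Qed.

Section Vertex.
Variable v : n.-tuple R.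
Hypothesis vv : is_vertex (row_of v).

Lemma vertex_affine_gt0 : 0 < affine A r ord_max v.
Proof. by case: vv => _; rewrite objectiveE. Qed.

Lemma vertex_feasible : (cube `&` polyhedron A r) v.
Proof. by apply/feasibleP; case: vv. Qed.

Lemma vertex_card : #|tight_affine v| = #|stars v|.
Proof.
apply/eqP; rewrite eqn_leq card_tight_affine ?gt_eqF ?vertex_affine_gt0//;
  last exact: vertex_feasible.
by rewrite card_stars//; case: vv.
Qed.

Lemma vertex_ord_max : ord_max \notin tight_affine v.
Proof. by rewrite inE gt_eqF// vertex_affine_gt0. Qed.

Lemma vertex_flat : (skeleton #|tight_affine v|%:Z `&` flat A r (tight_affine v)) v.
Proof.
split; first by split; [case: vertex_feasible|rewrite vertex_card].
apply: flat_tight_affine => //; first exact: vertex_feasible.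
by rewrite gt_eqF// vertex_affine_gt0.
Qed.

Lemma vertex_minors : minors_prod A (tight_affine v) v != 0.
Proof. by have [_] := good; apply; [exact: vertex_ord_max|exact: vertex_flat]. Qed.

Lemma vertex_det_frame : \det (frame v) != 0.
Proof. by apply/pins_frame; [exact: vertex_card|case: vv]. Qed.

(** Coordinates of the objective in the frame, that is, up to sign, its slopes
    along the edges at [v]. *)
Definition slope : 'cV[R]_n := invmx (frame v) *m col ord_max A.

Lemma frame_slope : col ord_max A = frame v *m slope.
Proof. by rewrite mulmxA mulmxV ?mul1mx// unitmxE unitfE vertex_det_frame. Qed.

Lemma prod_slope :
  \prod_j (facet_sign v j * slope j 0) * \det (frame v) ^+ n =
  (-1) ^+ (#|zeros v| + \sum_(s in stars v) s.+1) *
    minors_prod A (tight_affine v) v.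
Proof.
rewrite det_frame /minors_prod bullets_stars.
rewrite -(prod_signed_slopes vertex_card vertex_ord_max frame_slope)//.
apply/fintype.subsetP => j; rewrite finset.in_setC not_stars inE.
by move=> ->.
Qed.

Lemma slope_neq0 j : facet_sign v j * slope j 0 != 0.
Proof.
have : \prod_j (facet_sign v j * slope j 0) * \det (frame v) ^+ n != 0.
  by rewrite prod_slope mulf_neq0 ?signr_eq0// vertex_minors.
rewrite mulf_eq0 negb_or => /andP[/prodf_neq0 h _]; exact: h.
Qed.

(** Edges are found from the rows of the inverse of the frame, which are dual to
    its columns. *)
Definition edge_dir (t : N) : 'rV[R]_n :=
  if [pick j | facet v j == t] is Some j
  then - facet_sign v j *: row j (invmx (frame v)) else 0.

Lemma edge_dir_facet j :
  edge_dir (facet v j) = - facet_sign v j *: row j (invmx (frame v)).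
Proof.
rewrite /edge_dir; case: pickP => [k /eqP/(facet_inj vertex_card)->//|/(_ j)].
by rewrite eqxx.
Qed.

Lemma lin_edge_dir j k :
  lin (facet v j) (edge_dir (facet v k)) = (facet v j == facet v k)%:R.
Proof.
rewrite lin_facet edge_dir_facet -scalemxAl -row_mul mulVmx; last first.
  by rewrite unitmxE unitfE vertex_det_frame.
rewrite !mxE (inj_eq (facet_inj vertex_card)) eq_sym.
by case: eqP => [->|]; rewrite ?mulr0// mulr1 mulrNN facet_signK.
Qed.

Lemma goal_edge_dir j :
  lin goal (edge_dir (facet v j)) = - facet_sign v j * slope j 0.
Proof.
rewrite edge_dir_facet /lin -scalemxAl mxE; congr (_ * _).
by rewrite -row_mul mxE.
Qed.

End Vertex.

(** If the minor [minor A (stars v) I] vanishes, so does the term, since [n] is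
    positive; otherwise the constraints tight at [v] pin it.  The inequality
    between tight hyperplanes and stars then leaves [I] as the only choice. *)
Lemma vertex_of_term v I : (0 < n)%N -> (skeleton #|I|%:Z `&` flat A r I) v ->
  ord_max \notin I -> vertex_term A r I v != 0 ->
  is_vertex (row_of v) /\ tight_affine v = I.
Proof.
move=> n_gt0 [[cv [sI]] [[hI pv] /eqP av]] mI tv.
have IK : I \subset tight_affine v.
  by apply/fintype.subsetP => i iI; rewrite inE; apply/eqP/hI.
have KI : tight_affine v = I.
  apply/esym/eqP; rewrite eqEcard IK -sI.
  by apply: card_tight_affine.
split => //; split.
- exact/feasibleP.
- by rewrite objectiveE lt_def av; exact: pv.
- apply/pins_frame; first by rewrite KI.
  rewrite det_frame KI; apply: contraNneq tv => m0.
  by rewrite /vertex_term m0 mulr0 expr0n gtn_eqF// mulr0 mul0r.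
Qed.

(** * Volumes of the flipped cones *)

Section Cone.
Variable v : n.-tuple R.
Hypothesis vv : is_vertex (row_of v).

(** Slope of the objective along the edge that leaves [facet j]. *)
Definition gamma j := lin goal (edge_dir v (facet v j)).

Lemma gammaE j : gamma j = - facet_sign v j * slope v j 0.
Proof. exact: goal_edge_dir. Qed.

(** The flipped cone at [v], cut off where the objective vanishes. *)
Definition cone : set (n.-tuple R) :=
  [set t | (forall j, 0 <= - gamma j * slack (facet v j) (row_of t)) /\
           0 <= affine A r ord_max t].

Definition cone_sign : R := \prod_j - Num.sg (gamma j).

Lemma cone_flip t :
  (forall s, slack s (row_of t) != 0) -> 0 <= affine A r ord_max t ->
  \prod_(s in tight (row_of v))
    flip_sign (lin goal (edge_dir v s)) (slack s (row_of t)) =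
  cone_sign * \1_cone t.
Proof.
move=> st gt; have IJ := vertex_card vv.
rewrite tightE// big_imset /=; last by move=> i j _ _; exact: facet_inj.
have -> : \prod_(i in 'I_n) flip_sign (lin goal (edge_dir v (facet v i)))
     (slack (facet v i) (row_of t)) =
   \prod_(i in [set: 'I_n]%SET) flip_sign (gamma i) (slack (facet v i) (row_of t)).
  by apply: eq_bigl => i; rewrite finset.in_setT.
rewrite prod_flip_sign; last 2 first.
- by move=> i _; rewrite gammaE mulNr oppr_eq0; exact: slope_neq0.
- by move=> i _; exact: st.
congr (_ * _); first by apply: eq_bigl => i; rewrite finset.in_setT.
have sgn i : (0 <= - Num.sg (gamma i) * slack (facet v i) (row_of t)) =
   (0 <= - gamma i * slack (facet v i) (row_of t)).
  rewrite !mulNr !oppr_ge0 -[LHS]sgr_le0 -[RHS]sgr_le0 !sgrM.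
  by rewrite sgr_id.
rewrite indicE; congr (nat_of_bool _)%:R; apply/forall_inP/idP => [h|].
  rewrite inE; split=> // j; rewrite -sgn; apply: h; exact: finset.in_setT.
by rewrite inE => -[h _] j _; rewrite sgn.
Qed.

Definition cone_matrix : 'M[R]_n := frame v *m diag_mx (- (slope v)^T).

(** The coordinates of the affine map are [- gamma j] times the slacks of the
    walls through [v], and their sum is the drop of the objective from [v] to
    the point. *)
Lemma coneE : cone =
  affmap cone_matrix (- row_of v *m cone_matrix) @^-1`
    simplex (affine A r ord_max v).
Proof.
have IJ := vertex_card vv.
have E t j : tnth (affmap cone_matrix (- row_of v *m cone_matrix) t) j =
    - slope v j 0 * ((row_of t - row_of v) *m frame v) 0 j.
  rewrite tnth_mktuple -mulmxDl mulmxA mul_mx_diag !mxE mulrC.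
  by congr (_ * _); apply: eq_bigr => i _; rewrite !mxE.
have E1 t j : - gamma j * slack (facet v j) (row_of t) =
    tnth (affmap cone_matrix (- row_of v *m cone_matrix) t) j.
  have -> : slack (facet v j) (row_of t) = lin (facet v j) (row_of t - row_of v).
    have := facet_tight IJ j; rewrite inE => /eqP sv.
    have {1}-> : row_of t = 1 *: (row_of t - row_of v) + row_of v.
      by rewrite scale1r subrK.
    by rewrite slackD ?sv ?add0r ?mul1r//; exact: lin_linear.
  rewrite lin_facet E gammaE; move: (_ *m frame v) => X.
  transitivity (- (facet_sign v j * facet_sign v j * slope v j 0) * X 0 j).
    by ring.
  by rewrite facet_signK mul1r.
have E2 t : \sum_j tnth (affmap cone_matrix (- row_of v *m cone_matrix) t) j =
    affine A r ord_max v - affine A r ord_max t.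
  under eq_bigr => j _ do rewrite E mulNr mulrC.
  rewrite sumrN.
  transitivity (- ((row_of t - row_of v) *m frame v *m slope v) 0 0).
    by rewrite mxE.
  rewrite -mulmxA -frame_slope// mulmxBl !mxE opprB -!slack_affine /slack !linE.
  by rewrite opprD addrACA subrr addr0.
apply/seteqP; split => t [h1 h2].
  by split=> [j|]; rewrite -?E1// E2; lra.
by split=> [j|]; [rewrite E1|move: h2; rewrite E2; lra].
Qed.

Lemma measurable_cone : measurable cone.
Proof.
rewrite coneE -[X in measurable X]setTI; apply: measurable_affmap => //.
exact: measurable_simplex.
Qed.

Lemma vol_cone : vol n cone =
  (`|\det (frame v) * \prod_j gamma j|^-1 *
    (affine A r ord_max v ^+ n / n`!%:R))%:E.
Proof.
have dM : \det cone_matrix = \det (frame v) * \prod_j - slope v j 0.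
  rewrite det_mulmx det_diag; congr (_ * _); apply: eq_bigr => j _.
  by rewrite !mxE.
have prodE : `|\prod_j - slope v j 0| = `|\prod_j gamma j|.
  rewrite !normr_prod; apply: eq_bigr => j _; rewrite gammaE normrM normrN normrN.
  by rewrite /facet_sign; case: ifP => _; rewrite ?normrN1 ?normr1 mul1r.
have g0 j : gamma j != 0 by rewrite gammaE mulNr oppr_eq0; exact: slope_neq0.
have p0 : \prod_j gamma j != 0 by apply/prodf_neq0 => j _.
have dfr := vertex_det_frame vv.
rewrite coneE affmap_scales_vol; last 2 first.
- by rewrite -normr_eq0 dM normrM prodE mulf_neq0 ?normr_eq0.
- exact: measurable_simplex.
rewrite vol_simplex; last exact/ltW/(vertex_affine_gt0 vv).
by rewrite dM normrM prodE -normrM.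
Qed.

(** The sign of the cone turns the product of the absolute values of the slopes
    into the product of their opposites, which [prod_slope] expresses by
    minors. *)
Lemma cone_term :
  cone_sign * fine (vol n cone) = vertex_term A r (tight_affine v) v.
Proof.
rewrite vol_cone /= /vertex_term.
have g0 j : gamma j != 0 by rewrite gammaE mulNr oppr_eq0; exact: slope_neq0.
pose P := \prod_j - gamma j.
have P0 : P != 0 by apply/prodf_neq0 => j _; rewrite oppr_eq0.
have sP : cone_sign = Num.sg P.
  rewrite /P (big_morph _ (@sgrM R) (@sgr1 R)).
  by apply: eq_bigr => j _; rewrite sgrN.
have nP : `|\prod_j gamma j| = `|P|.
  by rewrite !normr_prod; apply: eq_bigr => j _; rewrite normrN.
have PE := prod_slope vv.
have PE' : P = \prod_j (facet_sign v j * slope v j 0).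
  by apply: eq_bigr => j _; rewrite gammaE mulNr opprK.
rewrite -PE' in PE; rewrite normrM nP sP.
have dfr := vertex_det_frame vv.
have mp := vertex_minors vv.
rewrite -!det_frame in PE dfr *.
move: PE mp; set s := (-1) ^+ _; set mp := minors_prod _ _ _.
set D := \det _ in dfr *.
move=> PE mp0.
have s0 : s != 0 by rewrite signr_eq0.
have ss : s * s = 1 by rewrite /s -exprD addnn -signr_odd odd_double.
have mpE : mp = s * (P * D ^+ n) by rewrite PE mulrA ss mul1r.
have sgP : Num.sg P * `|P|^-1 = P^-1.
  apply: (mulIf P0); rewrite mulVf// [X in _ * X]numEsg.
  by rewrite mulrACA mulVf ?normr_eq0// mulr1 -expr2 sqr_sg P0.
have nf : n`!%:R != 0 :> R by rewrite pnatr_eq0 -lt0n fact_gt0.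
rewrite [(`|D| * `|P|)^-1]invfM mulrA (mulrCA (Num.sg P)) sgP mpE exprMn.
have := expf_neq0 n dfr; move: (D ^+ n) (affine _ _ _ _ ^+ n) => Dn gn Dn0.
have aD : `|D| != 0 by rewrite normr_eq0.
field.
by rewrite s0 P0 nf aD Dn0.
Qed.

End Cone.

(** * The volume as a sum over the vertices *)

Lemma slackE s t : slack s (row_of t) = \sum_j tnth t j * gradient s j 0 + offset s.
Proof.
by rewrite /slack linE; congr (_ + _); apply: eq_bigr => j _; rewrite mxE.
Qed.

Definition walls : set (n.-tuple R) :=
  \big[setU/set0]_(s <- enum {: N}) [set t | slack s (row_of t) = 0].

Hypothesis nonconstant : forall i, exists v t, affine A r i v <> affine A r i t.

Lemma walls_null : measurable walls /\ vol n walls = 0%E.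
Proof.
have wall0 s : measurable [set t | slack s (row_of t) = 0] /\
    vol n [set t | slack s (row_of t) = 0] = 0%E.
  rewrite (_ : [set t | slack s (row_of t) = 0] =
    [set t | \sum_j tnth t j * gradient s j 0 + offset s = 0]); last first.
    by apply/seteqP; split => t /=; rewrite slackE.
  split; first exact: measurable_hyperplane.
  suff [j sj] : exists j, gradient s j 0 != 0.
    exact: (vol_hyperplane (a := fun j => gradient s j 0) _ sj).
  case: s => [[j b]|i] /=.
    exists j; rewrite !mxE !eqxx mulr1; case: b; by rewrite ?oppr_eq0 oner_eq0.
  apply: contrapT => noj; have [v [t]] := nonconstant i; apply.
  rewrite /affine; congr (_ + _); apply: eq_bigr => j _.
  have [->|Aj] := eqVneq (A j i) 0; first by rewrite !mul0r.
  by exfalso; apply: noj; exists j; rewrite mxE.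
rewrite /walls; apply: (big_ind (fun B => measurable B /\ vol n B = 0%E)).
- by split => //; exact: measure0.
- move=> B C [mB B0] [mC C0]; split; first exact: measurableU.
  by rewrite measureU0.
- by move=> s _; exact: wall0.
Qed.

Lemma not_walls t : ~ walls t -> forall s, slack s (row_of t) != 0.
Proof.
rewrite /walls -bigcup_seq => nw s; apply/eqP => s0; apply: nw.
by exists s => //=; rewrite mem_enum.
Qed.

Definition vertex_sets : {set {set N}} :=
  [set T | `[< exists x, is_vertex x /\ tight x = T >]]%SET.
Definition vertex_of T : n.-tuple R :=
  [tuple xget 0 [set x | is_vertex x /\ tight x = T] 0 j | j < n].

Lemma row_of_mktuple x : row_of [tuple x 0 j | j < n] = x.
Proof. by apply/rowP => j; rewrite mxE tnth_mktuple. Qed.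

Lemma row_of_inj : injective (@row_of R n).
Proof.
move=> v w /rowP e; apply: eq_from_tnth => j.
by have := e j; rewrite !mxE.
Qed.

Lemma vertex_ofP T : T \in vertex_sets ->
  is_vertex (row_of (vertex_of T)) /\ tight (row_of (vertex_of T)) = T.
Proof.
rewrite inE => /asboolP h; rewrite /vertex_of row_of_mktuple.
exact: (xgetPex 0 h).
Qed.

Lemma vertex_setsP x : is_vertex x -> tight x \in vertex_sets.
Proof. by move=> vx; rewrite inE; apply/asboolP; exists x. Qed.

Lemma vertex_of_tight v : is_vertex (row_of v) -> vertex_of (tight (row_of v)) = v.
Proof.
move=> vv; have [vw tw] := vertex_ofP (vertex_setsP vv).
set w := vertex_of _ in vw tw *.
apply: row_of_inj; apply/eqP; rewrite -subr_eq0; apply/eqP.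
case: vv => _ _; apply; apply/forall_inP => s sT.
have : slack s (row_of w) = 0.
  by move: (sT); rewrite -tw inE => /eqP.
have {1}-> : row_of w = 1 *: (row_of w - row_of v) + row_of v.
  by rewrite scale1r subrK.
rewrite slackD; last exact: lin_linear.
by move: sT; rewrite inE => /eqP ->; rewrite add0r mul1r => ->.
Qed.

(** Where the objective is negative both sides vanish, and where it is positive
    this is the expansion on the flat of the empty set of constraints. *)
Lemma cone_decomposition t : ~ walls t ->
  \1_(cube `&` polyhedron A r) t =
  \sum_(T in vertex_sets)
    cone_sign (vertex_of T) * \1_(cone (vertex_of T)) t.
Proof.
move=> /not_walls tw.
have [gt|gt] := leP 0 (affine A r ord_max t); last first.
  rewrite indicE memNset; last first.
    by move=> [_ /(_ ord_max I)]; rewrite /halfspace /= leNgt gt.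
  rewrite big1// => T _; rewrite indicE memNset ?mulr0//.
  by move=> [_]; rewrite leNgt gt.
have gt' : 0 < affine A r ord_max t.
  by rewrite lt_def gt andbT -slack_affine.
have <- : (feasible (row_of t))%:R = \1_(cube `&` polyhedron A r) t :> R.
  rewrite indicE; congr (nat_of_bool _)%:R; apply/idP/idP.
    by move=> /feasibleP h; rewrite inE.
  by rewrite inE => /feasibleP.
have dual T s u : T \in vertex_sets -> s \in T -> u \in T ->
    lin s (edge_dir (vertex_of T) u) = (s == u)%:R.
  move=> TV; have [vT tT] := vertex_ofP TV.
  rewrite -{1 2}tT => /(tight_facet (vertex_card vT))[j ->].
  move=> /(tight_facet (vertex_card vT))[k ->].
  exact: lin_edge_dir.
have edge T s : T \in vertex_sets -> s \in T ->
    lin goal (edge_dir (vertex_of T) s) != 0.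
  move=> TV; have [vT tT] := vertex_ofP TV.
  rewrite -{1}tT => /(tight_facet (vertex_card vT))[j ->].
  by rewrite goal_edge_dir// mulNr oppr_eq0; exact: slope_neq0.
rewrite (vertex_expansion lin_linear (lin_linear goal) cube_bounded vertex_ofP
  vertex_setsP dual edge (S := finset.set0)).
- apply: eq_big => T; rewrite finset.sub0set ?andbT// => TV.
  have [vT tT] := vertex_ofP TV.
  by rewrite -cone_flip// tT finset.setD0.
- by move=> s; rewrite finset.in_set0.
- by rewrite objectiveE.
- by move=> s _; exact: tw.
Qed.

Lemma measurable_polytope : measurable (cube `&` polyhedron A r).
Proof.
have -> : cube `&` polyhedron A r = \bigcap_(s in [set: N])
    [set t | 0 <= \sum_j tnth t j * gradient s j 0 + offset s].
  apply/seteqP; split => t.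
    by move=> /feasibleP/forallP h s _ /=; rewrite -slackE.
  by move=> h; apply/feasibleP/forallP => s; rewrite slackE; exact: h.
apply: fin_bigcap_measurable => [|s _]; first exact: finite_finset.
exact: measurable_halfspace.
Qed.

Lemma vol_vertices : vol n (cube `&` polyhedron A r) =
  (\sum_(T in vertex_sets)
     vertex_term A r (tight_affine (vertex_of T)) (vertex_of T))%:E.
Proof.
have [mW W0] := walls_null; have mP := measurable_polytope.
have DW B : measurable B -> vol n (B `\` walls) = vol n B.
  move=> mB; rewrite [RHS](measureDI _ mB mW).
  rewrite [X in (_ + X)%E](_ : _ = 0%E) ?adde0//.
  apply: (subset_measure0 _ _ (@subIsetr _ B walls) W0) => //.
  exact: measurableI.
rewrite -DW// (@measure_signed_indic _ _ _ (vol n) {set N} (mem vertex_sets)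
  (fun T => cone_sign (vertex_of T)) (fun T => cone (vertex_of T) `\` walls)).
- rewrite -sumEFin; apply: eq_bigr => T TV; have [vT _] := vertex_ofP TV.
  rewrite /= DW; last exact: measurable_cone.
  by rewrite -(cone_term vT) EFinM fineK// vol_cone.
- exact: measurableD.
- move=> T TV; have [vT _] := vertex_ofP TV.
  by apply: measurableD => //; exact: measurable_cone.
- move=> T TV; have [vT _] := vertex_ofP TV.
  by rewrite /= DW ?vol_cone ?ltry//; exact: measurable_cone.
- move=> t; have [wt|wt] := pselect (walls t).
    rewrite indicE memNset ?big1//; last by case.
    by move=> T _; rewrite indicE memNset ?mulr0//; case.
  have ind B : \1_(B `\` walls) t = \1_B t :> R.
    rewrite !indicE; congr (nat_of_bool _)%:R.
    by apply/idP/idP; rewrite !inE => // -[].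
  rewrite ind cone_decomposition//; apply: eq_bigr => T _; by rewrite ind.
Qed.

(** By [vertex_of_term], the nonzero terms of the sum come from finitely many
    points, the vertices whose set of tight hyperplanes is [I]. *)
Lemma sum_vertices I : (0 < n)%N -> ord_max \notin I ->
  \sum_(v \in skeleton #|I|%:Z `&` flat A r I) vertex_term A r I v =
  \sum_(T in vertex_sets | tight_affine (vertex_of T) == I)
     vertex_term A r (tight_affine (vertex_of T)) (vertex_of T).
Proof.
move=> n_gt0 mI.
pose VI := [set T in vertex_sets | tight_affine (vertex_of T) == I]%SET.
have VIE T : (T \in VI) =
    (T \in vertex_sets) && (tight_affine (vertex_of T) == I).
  by rewrite [LHS]inE.
have inD v : v \in [seq vertex_of T | T <- enum VI] ->
    (skeleton #|I|%:Z `&` flat A r I) v.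
  move=> /mapP[T]; rewrite mem_enum VIE => /andP[TV /eqP <-] ->.
  by apply: vertex_flat => //; case: (vertex_ofP TV).
rewrite (fsbigE [seq vertex_of T | T <- enum VI]).
- rewrite big_seq_cond.
  rewrite (eq_bigl (fun v => v \in [seq vertex_of T | T <- enum VI])); last first.
    by move=> v; case: (boolP (v \in _)) => [/inD/mem_set|/negbTE].
  rewrite -big_seq big_map big_enum /=.
  by apply: eq_big => T; rewrite VIE// => /andP[_ /eqP ->].
- rewrite map_inj_in_uniq ?enum_uniq// => T U.
  rewrite !mem_enum !VIE => /andP[/vertex_ofP[_ tT] _] /andP[/vertex_ofP[_ tU] _] e.
  by rewrite -tT -tU e.
- by move=> v; exact: inD.
- move=> v Dv; apply: contraNeq => tv.
  have [vv KI] := vertex_of_term n_gt0 Dv mI tv.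
  apply/mapP; exists (tight (row_of v)); last by rewrite vertex_of_tight.
  by rewrite mem_enum VIE vertex_setsP//= vertex_of_tight// KI.
Qed.

End Clipping.

Theorem theorem4p5 (R : realType) (n m : nat) (n_gt0 : (0 < n)%N)
    (A : 'M[R]_(n, m.+1)) (r : 'rV[R]_m.+1)
    (nonconstant : forall i, exists x y, affine A r i x <> affine A r i y)
    (good : good_clipping A r) :
  vol n (cube `&` polyhedron A r) =
  (\sum_(I : {set 'I_m.+1} | ord_max \notin I)
     \sum_(v \in skeleton #|I|%:Z `&` flat A r I) vertex_term A r I v)%:E.
Proof.
rewrite vol_vertices//; congr EFin.
rewrite (eq_bigr _ (fun I mI => sum_vertices good n_gt0 mI)).
apply: (partition_big (fun T => tight_affine A r (vertex_of A r T))) => T TV.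
by apply: vertex_ord_max; case: (vertex_ofP TV).
Qed.
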